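(* Let $G_1$ be a simple, non-amenable, locally compact second countable group, and let $G_2$ be a simple, countable, discrete group. Then every non-trivial irreducible probability measure preserving action of $G=G_1\times G_2$ is essentially free. It follows that every irreducible invariant random subgroup of $G$ is almost surely equal to a (fixed) normal subgroup of $G$.
   Context: A locally compact group is simple if it has no closed normal subgroups other than the trivial group and itself. A probability measure preserving (pmp) action is a Borel action on a standard probability space $(X,m)$ preserving the measure. It is trivial if every group element fixes $m$-almost every point, and essentially free if the stabilizer of $m$-almost every point is trivial. A pmp action of $G=G_1\times G_2$ is irreducible if the restricted actions of both $G_1$ and $G_2$ are ergodic. $\mathrm{Sub}_G$ is the compact metrizable space of closed subgroups of $G$ with the Chabauty topology; $G$ acts on it by conjugation. An invariant random subgroup (IRS) of $G$ is a random variable $K$ with values in $\mathrm{Sub}_G$ whose law $\lambda$ is a conjugation-invariant Borel probability measure; $K$ is irreducible if the conjugation action $G\curvearrowright(\mathrm{Sub}_G,\lambda)$ is irreducible. *)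

(* Defs.v *)
From HB Require Import structures.
From mathcomp Require Import all_boot all_order all_algebra.
From mathcomp Require Import all_classical all_reals all_analysis.

Set Implicit Arguments.
Unset Strict Implicit.
Unset Printing Implicit Defensive.

Import Order.TTheory GRing.Theory Num.Theory.
Import numFieldNormedType.Exports.

Local Open Scope classical_set_scope.
Local Open Scope ring_scope.

(* Topological groups, in multiplicative notation. No separation axiom is
   built in. [Pointed] is only there because the measurable types of the library
   are pointed. *)

HB.mixin Record isTopologicalGroup G of Topological G & monoid.Group G := {
  mulg_continuous : continuous (fun x : G * G => (x.1 * x.2)%g) ;
  invg_continuous : continuous (fun x : G => x^-1%g)
}.

#[short(type="topologicalGroupType")]
HB.structure Definition TopologicalGroup :=
  {G of Pointed G & Topological G & monoid.Group G & isTopologicalGroup G}.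

Lemma continuous_pair (T U V : topologicalType) (f : T -> U) (g : T -> V) :
  continuous f -> continuous g -> continuous (fun x => (f x, g x)).
Proof. by move=> cf cg x; apply: cvg_pair; [exact: cf|exact: cg]. Qed.

Lemma continuous_fst_comp (T U V : topologicalType) (f : T -> U * V) :
  continuous f -> continuous (fun x => (f x).1).
Proof.
by move=> cf x; apply: (continuous_comp (f := f)); [exact: cf|exact: cvg_fst].
Qed.

Lemma continuous_snd_comp (T U V : topologicalType) (f : T -> U * V) :
  continuous f -> continuous (fun x => (f x).2).
Proof.
by move=> cf x; apply: (continuous_comp (f := f)); [exact: cf|exact: cvg_snd].
Qed.

Lemma continuous_mulg (T : topologicalType) (G : topologicalGroupType)
    (f g : T -> G) :
  continuous f -> continuous g -> continuous (fun x => f x * g x)%g.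
Proof.
move=> cf cg x; apply: (continuous_comp (f := fun x => (f x, g x))
  (g := fun y : G * G => (y.1 * y.2)%g)); last exact: mulg_continuous.
exact: continuous_pair.
Qed.

Lemma continuous_invg (T : topologicalType) (G : topologicalGroupType)
    (f : T -> G) : continuous f -> continuous (fun x => (f x)^-1)%g.
Proof.
by move=> cf x; apply: (continuous_comp (f := f));
  [exact: cf|exact: invg_continuous].
Qed.

Lemma continuous_idfun (T : topologicalType) : continuous (fun x : T => x).
Proof. by move=> x; exact: cvg_id. Qed.

Section prod_group.
Variables G1 G2 : topologicalGroupType.

Lemma pair_mulg_continuous :
  continuous (fun x : (G1 * G2) * (G1 * G2) => (x.1 * x.2)%g).
Proof.
have cid := @continuous_idfun ((G1 * G2) * (G1 * G2))%type.
have c1 := continuous_fst_comp cid; have c2 := continuous_snd_comp cid.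
apply: (@continuous_pair _ G1 G2).
  apply: continuous_mulg; exact: continuous_fst_comp.
apply: continuous_mulg; exact: continuous_snd_comp.
Qed.

Lemma pair_invg_continuous : continuous (fun x : G1 * G2 => x^-1%g).
Proof.
have cid := @continuous_idfun (G1 * G2)%type.
apply: (@continuous_pair _ G1 G2).
  apply: continuous_invg; exact: continuous_fst_comp.
apply: continuous_invg; exact: continuous_snd_comp.
Qed.

HB.instance Definition _ := isTopologicalGroup.Build (G1 * G2)%type
  pair_mulg_continuous pair_invg_continuous.

End prod_group.

Definition lcsc (G : topologicalGroupType) : Prop :=
  [/\ hausdorff_space G, locally_compact [set: G] & @second_countable G].

Notation borel T := (g_sigma_algebraType (@open T)).

Record closedSubgroup (G : topologicalGroupType) := ClosedSubgroup {
  csub_set :> set G ;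
  csub_closed : closed csub_set ;
  csub1 : csub_set 1%g ;
  csubM : forall x y, csub_set x -> csub_set y -> csub_set (x * y)%g ;
  csubV : forall x, csub_set x -> csub_set x^-1%g
}.

Lemma closedSubgroup_eq (G : topologicalGroupType) (H K : closedSubgroup G) :
  H = K :> set G -> H = K.
Proof.
case: H K => [H ? ? ? ?] [K ? ? ? ?] /= HK; subst K.
by congr ClosedSubgroup; exact: Prop_irrelevance.
Qed.

(* The Chabauty topology: the sets of subgroups missing a given compact set, or
   meeting a given open set, form a subbase. *)
Section chabauty.
Variable G : topologicalGroupType.

HB.instance Definition _ := gen_eqMixin (closedSubgroup G).
HB.instance Definition _ := gen_choiceMixin (closedSubgroup G).

Definition full_csub : closedSubgroup G :=
  @ClosedSubgroup G setT closedT I (fun _ _ _ _ => I) (fun _ _ => I).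

HB.instance Definition _ := isPointed.Build (closedSubgroup G) full_csub.

Definition chabauty_subbase : set (set (closedSubgroup G)) :=
  [set [set H : closedSubgroup G | H `&` C = set0] |
     C in [set C : set G | compact C]] `|`
  [set [set H : closedSubgroup G | H `&` U !=set0] |
     U in [set U : set G | open U]].

HB.instance Definition _ :=
  isSubBaseTopological.Build (closedSubgroup G) chabauty_subbase id.

End chabauty.

(* As [x ^ g = g^-1 * (x * g)], the set below is [g H g^-1]. *)
Definition conj_set (G : topologicalGroupType) (g : G) (H : set G) : set G :=
  [set x | H (x ^ g)%g].

Lemma conj_setE (G : topologicalGroupType) (g : G) (H : set G) :
  conj_set g H = [set (g * x * g^-1)%g | x in H].
Proof.
apply/seteqP; split=> [x Hx|_ [x Hx <-]] /=.
  by exists (x ^ g)%g => //; rewrite conjgE !mulgA mulgV mul1g mulgK.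
by rewrite /conj_set /= conjgE !mulgA mulVg mul1g mulgVK.
Qed.

Section conj_csub.
Variables (G : topologicalGroupType) (g : G) (H : closedSubgroup G).

Lemma conj_set_closed : closed (conj_set g H).
Proof.
have cg : continuous (fun x : G => (x ^ g)%g).
  apply: (@continuous_mulg G G (fun=> g^-1%g) (fun x => x * g)%g).
    by move=> x; exact: cvg_cst.
  apply: continuous_mulg; first exact: continuous_idfun.
  by move=> x; exact: cvg_cst.
by apply: preimage_closed => [x _|]; [exact: cg|exact: csub_closed].
Qed.

Lemma conj_set1 : conj_set g H 1%g.
Proof. by rewrite /conj_set /= conj1g; exact: csub1. Qed.

Lemma conj_setM x y :
  conj_set g H x -> conj_set g H y -> conj_set g H (x * y)%g.
Proof. by rewrite /conj_set /= conjMg; exact: csubM. Qed.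

Lemma conj_setV x : conj_set g H x -> conj_set g H x^-1%g.
Proof. by rewrite /conj_set /= conjVg; exact: csubV. Qed.

Definition conj_csub : closedSubgroup G :=
  ClosedSubgroup conj_set_closed conj_set1 conj_setM conj_setV.

End conj_csub.

Definition normal_csub (G : topologicalGroupType) (N : closedSubgroup G) : Prop :=
  forall g : G, conj_csub g N = N.

Definition simple_tgroup (G : topologicalGroupType) : Prop :=
  forall N : closedSubgroup G, normal_csub N ->
    N = [set 1%g] :> set G \/ N = [set: G] :> set G.

(* On a locally compact second countable group, a Borel measure that is finite
   on compact sets is automatically regular. *)
Definition left_haar (R : realType) (G : topologicalGroupType)
    (mu : {measure set (borel G) -> \bar R}) : Prop :=
  [/\ mu [set: G] != 0%E,
      (forall C : set G, compact C -> mu C < +oo)%E &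
      forall (g : G) (A : set (borel G)), measurable A ->
        mu [set (g * x)%g | x in A] = mu A].

(* A mean on L^oo, presented as a functional on essentially bounded measurable
   functions that is compatible with almost-everywhere equality; its values
   outside [Lfun mu +oo] are irrelevant. *)
Record left_invariant_mean (R : realType) (G : topologicalGroupType)
    (mu : {measure set (borel G) -> \bar R}) (M : (borel G -> R) -> R) : Prop := {
  mean_ae : forall f h, f \in Lfun mu +oo -> h \in Lfun mu +oo ->
    f = h %[ae mu] -> M f = M h ;
  mean_linear : forall (c : R) f h, f \in Lfun mu +oo -> h \in Lfun mu +oo ->
    M (fun x => c * f x + h x) = c * M f + M h ;
  mean_ge0 : forall f, f \in Lfun mu +oo -> (forall x, 0 <= f x) -> 0 <= M f ;
  mean1 : M (fun _ => 1) = 1 ;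
  mean_invariant : forall (g : G) f, f \in Lfun mu +oo ->
    M (fun x => f (g^-1 * x)%g) = M f
}.

(* Haar measure is unique up to scaling, so the choice of [mu] does not matter. *)
Definition amenable (R : realType) (G : topologicalGroupType) : Prop :=
  exists2 mu : {measure set (borel G) -> \bar R}, left_haar mu &
    exists M : (borel G -> R) -> R, left_invariant_mean mu M.

Section actions.
Variables (G : groupType) (X : Type).

Definition is_group_action (a : G -> X -> X) : Prop :=
  (forall x, a 1%g x = x) /\ (forall g h x, a (g * h)%g x = a g (a h x)).

Definition stabilizer (a : G -> X -> X) (x : X) : set G := [set g | a g x = x].

End actions.

(* The measurable space X is Borel-isomorphic to a Polish space. *)
Definition standard_borel (R : realType) d (X : measurableType d) : Prop :=
  exists (Y : completePseudoMetricType R) (f : X -> Y),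
    [/\ hausdorff_space Y,
        exists2 D : set Y, countable D & dense D,
        bijective f &
        forall A : set X,
          measurable A <-> measurable (f @` A : set (borel Y))].

Section measured_actions.
Variables (R : realType) (d : measure_display) (X : measurableType d).

Definition measure_preserving (G : groupType) (m : probability X R)
    (a : G -> X -> X) : Prop :=
  forall (g : G) (A : set X), measurable A -> m (a g @^-1` A) = m A.

Definition pmp_action (G : topologicalGroupType) (m : probability X R)
    (a : G -> X -> X) : Prop :=
  [/\ standard_borel R X,
      is_group_action a,
      measurable_fun [set: borel G * X] (fun p : borel G * X => a p.1 p.2) &
      measure_preserving m a].

Definition trivial_action (G : groupType) (m : probability X R)
    (a : G -> X -> X) : Prop :=
  forall g : G, \forall x \ae m, a g x = x.

Definition essentially_free (G : groupType) (m : probability X R)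
    (a : G -> X -> X) : Prop :=
  \forall x \ae m, stabilizer a x = [set 1%g].

Definition ergodic (G : groupType) (m : probability X R)
    (a : G -> X -> X) : Prop :=
  forall A : set X, measurable A -> (forall g : G, a g @^-1` A = A) ->
    m A = 0%E \/ m A = 1%E.

Definition irreducible (G1 G2 : groupType) (m : probability X R)
    (a : G1 * G2 -> X -> X) : Prop :=
  ergodic m (fun g1 : G1 => a (g1, 1%g)) /\
  ergodic m (fun g2 : G2 => a (1%g, g2)).

End measured_actions.

(* Sub_G carries the Borel sigma-algebra of the Chabauty topology, and
   [distribution P K] is the law of K. *)
Definition is_IRS (R : realType) (G : topologicalGroupType) d
    (Omega : measurableType d) (P : probability Omega R)
    (K : {RV P >-> borel (closedSubgroup G)}) : Prop :=
  measure_preserving (distribution P K) (@conj_csub G).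

Definition irreducible_IRS (R : realType) (G1 G2 : topologicalGroupType) d
    (Omega : measurableType d) (P : probability Omega R)
    (K : {RV P >-> borel (closedSubgroup (G1 * G2)%type)}) : Prop :=
  is_IRS K /\ irreducible (distribution P K) (@conj_csub (G1 * G2)%type).

(* Main.v *)
Require Import Defs.
From HB Require Import structures.
From mathcomp Require Import all_boot all_order all_algebra finmap.
From mathcomp Require Import all_classical all_reals all_analysis.
From mathcomp Require Import measurable_realfun ess_sup_inf ring lra.

(** Write [m] for the invariant probability on the space [X]. If [m] is a point
    mass, its atom is fixed by [G], and the action is trivial. Otherwise the
    action is essentially free, for the following reason.

    Data extracted from the stabilizer of a point that are equivariant under one
    factor and unaffected by the other are almost surely constant, since each
    factor acts ergodically; being constant and equivariant they are normal, and
    simplicity leaves two cases. In this way, the elements of [G2] acting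
    trivially almost everywhere form a normal subgroup, and each [h != 1] in
    [G2] fixes almost no point ([G2_free]); the stabilizer in [G1] of almost
    every point is one and the same normal closed subgroup, hence trivial
    ([G1_free]); and the projection of the stabilizer to [G2] is almost surely
    one and the same normal subgroup, hence [1] or [G2]. If it is [1], the action
    is essentially free. If it is [G2], fix [h != 1] in [G2]: for almost every
    [x] there is exactly one [phi x] in [G1] such that [(phi x, h)] fixes [x].
    Moving [x] by [G1] conjugates [phi x], so the law of [phi] is a
    conjugation-invariant probability on [G1], and it gives no mass to [1] since
    [h] fixes almost no point ([stabilizer_above_neq1]).

    A simple locally compact second countable group carrying such a probability
    [lam] is amenable ([amenable_of_conj_invariant]), which contradicts the
    hypothesis on [G1]. The averaging operator [P], where [P f x] is the integral
    of [f (k * x)] over [k] against [lam], commutes with left translations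
    because [lam] is invariant under conjugation. Let [L] be a limit of the
    Cesaro means of the random walk with step [lam]; it is a mean with
    [L (P f) = L f]. For a function [w] with [P w] close to [w], the integral
    over [k] of [L ((w (k * x) - w x) ^ 2)] is
    [L (P (w ^ 2) - 2 w (P w) + w ^ 2)], which is close to [0]; so the value of
    [L] on [w] nearly equals its value on most translates of [w] by [lam]-random
    elements. The Cesaro means [w] of the functions [P ^ n f] have this property,
    satisfy [L w = L f], and are compatible with translations; hence [L] is
    invariant under translation by the support of [lam]. This is the argument of
    Choquet and Deny, made quantitative in [walk_mean_variance]. The walk starts
    from a probability that moves continuously under translations, so the
    translations preserving [L] form a closed subgroup. The support of [lam]
    generates a closed normal subgroup, which is everything by simplicity. Since
    amenability refers to a mean on the bounded functions modulo Haar-null sets,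
    a Haar measure is constructed from covering numbers ([haar_exists]).

    The sets of points that occur above are projections along [G1], so their
    measurability needs an argument. Countably many measurable sets [S n]
    separate the points of [X]; the Haar measure of the set of [g] in a compact
    set such that [g^-1] sends [x] into [S n] is continuous along the orbits, and
    such functions of [x] still separate the points
    ([orbit_continuous_coordinates]). Stabilizers are therefore closed, and the
    points fixed by some [(g, h)] with [g] in a given compact set are found by
    approximation along a dense sequence ([fixed_by_cell_measurable]).

    The same dichotomy ([dirac_or_free]) applies to [G] acting by conjugation on
    its space of closed subgroups. There a subgroup lies in its own stabilizer,
    so that an essentially free action is carried by the trivial subgroup, and a
    point mass sits at a normal subgroup. *)

Set Implicit Arguments.
Unset Strict Implicit.
Unset Printing Implicit Defensive.

Import Order.TTheory GRing.Theory Num.Theory.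
Import numFieldNormedType.Exports.

Local Open Scope classical_set_scope.
Local Open Scope ring_scope.

(** * Locally compact second countable spaces *)

(** Asking for closures inside [W] makes every open set a countable union of
    compact sets, which reduces questions of measurability to compact sets. *)
Definition compact_basis (T : topologicalType) (B : nat -> set T) :=
  [/\ forall i, open (B i), forall i, compact (closure (B i)) &
      forall x W, nbhs x W -> exists2 i, B i x & closure (B i) `<=` W].

(** Countable families are handled as sequences; a sequence is allowed to take
    values outside the given set, which covers the empty set. *)
Lemma countable_seqP (T : pointedType) (S : set T) : countable S ->
  exists f : nat -> T, S `<=` range f.
Proof.
move=> /countable_injP[g injg].
exists (fun n => get [set t | S t /\ g t = n]) => t St.
exists (g t) => //.
have [Sx gx] := @getPex _ [set u | S u /\ g u = g t] (ex_intro _ t (conj St erefl)).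
by apply: injg; rewrite ?inE.
Qed.

(** Keep the open sets with compact closure from a countable basis, and replace
    the others by the empty set. *)
Lemma lcsc_compact_basis (T : ptopologicalType) : hausdorff_space T ->
  locally_compact [set: T] -> @second_countable T ->
  exists B : nat -> set T, compact_basis B.
Proof.
move=> hT lT [S cS [oS bS]].
have [f fS] := countable_seqP cS.
exists (fun n => if pselect (open (f n) /\ compact (closure (f n))) then f n
  else set0); split=> [n|n|x W xW].
- by case: pselect => [p|_] /=; [exact: p.1|exact: open0].
- by case: pselect => [p|_] /=; [exact: p.2|rewrite closure0; exact: compact0].
have := lT x I; rewrite withinET => -[C xC [cC clC]].
have [V xV VW] := compact_regular hT cC xC xW.
have [U [SU Ux] UVC] := bS x _ (filterI xV xC).
have cU : compact (closure U).
  apply: (subclosed_compact _ cC); first exact: closed_closure.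
  by rewrite [C in _ `<=` C](closure_id C).1//; apply: closureS => y /UVC[].
have [n _ fnU] := fS _ SU.
have okU : open (f n) /\ compact (closure (f n)) by rewrite fnU; split=> //; exact: oS.
exists n; case: pselect => //= _; rewrite fnU //.
by apply: subset_trans VW; apply: closureS => y /UVC[].
Qed.

Section compact_basis_theory.
Variables (T : ptopologicalType) (B : nat -> set T).
Hypotheses (hT : hausdorff_space T) (bB : compact_basis B).

Lemma compact_basis_bigcup (U : set T) : open U ->
  U = \bigcup_(i in [set i | closure (B i) `<=` U]) closure (B i).
Proof.
case: bB => _ _ b3 oU; apply/seteqP; split => [x Ux|x [i]]; last exact.
have [i Bix BiU] := b3 x U (open_nbhs_nbhs (conj oU Ux)).
by exists i => //; exact: subset_closure.
Qed.

Lemma compact_shrink (K U : set T) : compact K -> open U -> K `<=` U ->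
  exists W, [/\ open W, K `<=` W, closure W `<=` U & compact (closure W)].
Proof.
case: (bB) => b1 b2 b3; rewrite {1}compact_cover => cK oU KU.
have [i Di|x Kx|D' sD' KD'] := cK nat [set i | closure (B i) `<=` U] B.
- exact: b1.
- have [i Bix BiU] := b3 x U (open_nbhs_nbhs (conj oU (KU _ Kx))).
  by exists i.
have sub : closure (\bigcup_(i in [set` D']) B i) `<=`
    \bigcup_(i in [set` D']) closure (B i).
  have /closure_id -> : closed (\bigcup_(i in [set` D']) closure (B i)).
    by apply: closed_bigcup => // i _; exact: closed_closure.
  by apply: closureS => x [i Di Bix]; exists i => //; exact: subset_closure.
exists (\bigcup_(i in [set` D']) B i); split => //.
- by apply: bigcup_open => i _; exact: b1.
- by move=> x /sub[i] /sD'; rewrite inE; apply.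
- apply: (subclosed_compact _ _ sub); first exact: closed_closure.
  by rewrite bigcup_fset; apply: bigsetU_compact => i _; exact: b2.
Qed.

(** This is what makes a content subadditive on open sets. *)
Lemma compact_split (K U V : set T) : compact K -> open U -> open V ->
  K `<=` U `|` V -> exists K1 K2, [/\ compact K1, compact K2, K1 `<=` U,
    K2 `<=` V & K = K1 `|` K2].
Proof.
move=> cK oU oV KUV; have clK := compact_closed hT cK.
have [|x [Kx nUx]|W [oW KW WV cW]] := @compact_shrink (K `\` U) V _ oV.
- apply: (subclosed_compact _ cK); last exact: subDsetl.
  by rewrite setDE; apply: closedI => //; exact: open_closedC.
- by case: (KUV x Kx).
exists (K `\` W), (K `&` closure W); split => //.
- apply: (subclosed_compact _ cK); last exact: subDsetl.
  by rewrite setDE; apply: closedI => //; exact: open_closedC.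
- by apply: compact_closedI => //; exact: closed_closure.
- move=> x [Kx nWx]; apply: contrapT => nUx; exact/nWx/KW.
- by move=> x [_ /WV].
- apply/seteqP; split=> [x Kx|x [[]|[]]//].
  by have [Wx|nWx] := pselect (W x); [right; split=> //; exact: subset_closure|left].
Qed.

End compact_basis_theory.

(** * Translations, and limits along filters *)

Section translations.
Variable G : topologicalGroupType.
Implicit Types (g : G) (A : set G).

Lemma lmulg_continuous g : continuous (fun x : G => (g * x)%g).
Proof.
apply: continuous_mulg; last exact: continuous_idfun.
by move=> x; exact: cvg_cst.
Qed.

Lemma rmulg_continuous g : continuous (fun x : G => (x * g)%g).
Proof.
apply: continuous_mulg; first exact: continuous_idfun.
by move=> x; exact: cvg_cst.
Qed.

Lemma conjg_continuous g : continuous (fun x : G => (x ^ g)%g).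
Proof.
apply: (@continuous_mulg G G (fun=> g^-1%g) (fun x => x * g)%g).
  by move=> x; exact: cvg_cst.
exact: rmulg_continuous.
Qed.

Lemma lcosetE g A : [set (g * x)%g | x in A] = (fun x => (g^-1 * x)%g) @^-1` A.
Proof.
apply/seteqP; split=> [_ [x Ax <-]/=|x Ax]; first by rewrite mulKg.
by exists (g^-1 * x)%g => //; rewrite mulVKg.
Qed.

Lemma lcosetK g A : [set (g^-1 * x)%g | x in [set (g * x)%g | x in A]] = A.
Proof.
apply/seteqP; split=> [_ [_ [x Ax <-] <-]|x Ax]; first by rewrite mulKg.
by exists (g * x)%g; [exists x|rewrite mulKg].
Qed.

Lemma lcoset_open g A : open A -> open [set (g * x)%g | x in A].
Proof.
by move=> oA; rewrite lcosetE; apply: open_comp => // x _; exact: lmulg_continuous.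
Qed.

Lemma lcoset_compact g A : compact A -> compact [set (g * x)%g | x in A].
Proof.
move=> cA; apply: continuous_compact => //; apply: continuous_subspaceT.
exact: lmulg_continuous.
Qed.

End translations.

Section ultralimit.
Variables (R : realType) (I : Type) (U : set_system I).
Hypothesis UU : UltraFilter U.

(** Limits along an ultrafilter replace the extraction of subsequences, and
    Tychonoff arguments, in the constructions of Haar measure and of means. *)
Lemma ultra_bounded_cvg (u : I -> R) (C : R) :
  (forall i, `|u i| <= C)%R -> cvg (u @ U).
Proof.
move=> uC.
have uU : (u @ U) `[(- C)%R, C]%classic.
  apply: (filterE (F := U)) => i; by rewrite /= in_itv/= -ler_norml.
have [l [_ cl]] := @segment_compact R (- C)%R C (u @ U) _ uU.
apply/cvg_ex; exists l => V lV.
have [//|nV] := in_ultra_setVsetC (u @^-1` V) UU.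
by have [x [nVx /nVx]] := cl (~` V) V nV lV.
Qed.

End ultralimit.

Lemma le_cvg_along (R : realType) (I : Type) (F : set_system I)
    (FF : ProperFilter F) (f g : I -> R) (l l' : R) :
  f @ F --> l -> g @ F --> l' -> (\forall i \near F, f i <= g i)%R -> (l <= l')%R.
Proof.
move=> fl gl' fg; rewrite -subr_ge0.
have fgl := cvgB (FF := @filter_filter _ _ FF) gl' fl; rewrite -(cvg_lim (@Rhausdorff R) fgl).
apply: limr_ge; first by apply/cvg_ex; exists (l' - l)%R.
by apply: filterS fg => i; rewrite subr_ge0.
Qed.

(** * Covering numbers and the Haar content *)

Section covering_number.
Variable G : topologicalGroupType.
Implicit Types (A K V : set G) (n : nat).

Definition covered A V n := exists2 s : seq G, (size s <= n)%N &
  A `<=` \bigcup_(g in [set` s]) [set (g * x)%g | x in V].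

(** The value [0] stands for the absence of a finite covering, which does not
    occur for a compact [A] and a neighborhood [V] of [1]. *)
Definition covering_number A V : nat :=
  if pselect (exists n, `[< covered A V n >]) is left h then ex_minn h else 0.

Local Notation cov := covering_number.

Lemma covering_number_le A V n : covered A V n -> (cov A V <= n)%N.
Proof.
move=> An; rewrite /cov; case: pselect => // h.
by case: ex_minnP => m _; apply; exact/asboolP.
Qed.

Lemma covering_numberP A V n : covered A V n -> covered A V (cov A V).
Proof.
move=> An; rewrite /cov; case: pselect => [h|[]]; last by exists n; exact/asboolP.
by case: ex_minnP => m /asboolP.
Qed.

Lemma compact_covered K V : compact K -> nbhs 1%g V -> exists n, covered K V n.
Proof.
rewrite compact_cover => cK nV.
have [g Kg|x Kx|D' _ KD'] :=
    cK G K (fun g => [set (g * x)%g | x in V°]).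
- by apply: lcoset_open; exact: open_interior.
- by exists x => //; exists 1%g; [exact: nbhs_singleton (nbhs_interior nV)|rewrite mulg1].
exists (size D'), D' => // x /KD'[g D'g [y Vy <-]]; exists g => //; exists y => //.
exact: interior_subset.
Qed.

Lemma coveredS A A' V n : A `<=` A' -> covered A' V n -> covered A V n.
Proof. by move=> AA' [s sn A's]; exists s => // x /AA'/A's. Qed.

Lemma covering_numberS A A' V n : A `<=` A' -> covered A' V n ->
  (cov A V <= cov A' V)%N.
Proof.
move=> AA' A'n; apply: covering_number_le; apply: (coveredS AA').
exact: covering_numberP A'n.
Qed.

Lemma coveredU A A' V m n : covered A V m -> covered A' V n ->
  covered (A `|` A') V (m + n).
Proof.
move=> [s sm As] [t tn A't]; exists (s ++ t); first by rewrite size_cat leq_add.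
by move=> x [/As|/A't] [g /= gs gx]; exists g; rewrite //= mem_cat gs ?orbT.
Qed.

Lemma covering_numberU A A' V m n : covered A V m -> covered A' V n ->
  (cov (A `|` A') V <= cov A V + cov A' V)%N.
Proof.
move=> Am A'n; apply: covering_number_le.
by apply: coveredU; apply: covering_numberP; [exact: Am|exact: A'n].
Qed.

(** When no translate of [V] meets both sets, a covering of the union splits into
    a covering of each of them. *)
Lemma covering_number_disjoint A A' V n : covered (A `|` A') V n ->
  (forall g x y, V x -> V y -> A (g * x)%g -> A' (g * y)%g -> False) ->
  (cov A V + cov A' V <= cov (A `|` A') V)%N.
Proof.
move=> /covering_numberP[s sn AA's] sep.
pose meets (X : set G) g := `[< exists2 x, V x & X (g * x)%g >].
have key X : X `<=` A `|` A' -> (cov X V <= count (meets X) s)%N.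
  move=> XAA'; apply: covering_number_le; exists [seq g <- s | meets X g].
    by rewrite size_filter.
  move=> x Xx; have [g gs [y Vy gyx]] := AA's x (XAA' x Xx).
  exists g; last by exists y.
  by rewrite /= mem_filter gs andbT; apply/asboolP; exists y => //; rewrite gyx.
have := leq_add (key A (@subsetUl _ _ _)) (key A' (@subsetUr _ _ _)).
move=> /leq_trans; apply; apply: leq_trans sn.
rewrite -count_predUI (@eq_count _ (predI _ _) pred0) ?count_pred0 ?addn0 ?count_size//.
move=> g /=; apply/negbTE/negP => /andP[/asboolP[x Vx Ax] /asboolP[y Vy Ay]].
exact: (sep g x y).
Qed.

Lemma covered_lcoset g A V n :
  covered A V n -> covered [set (g * x)%g | x in A] V n.
Proof.
move=> [s sn As]; exists (map (fun k => (g * k)%g) s); first by rewrite size_map.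
move=> _ [x /As[k /= ks [y Vy <-]] <-]; exists (g * k)%g; first exact: map_f.
by exists y => //; rewrite mulgA.
Qed.

Lemma covering_number_lcoset_le g A V n : covered A V n ->
  (cov [set (g * x)%g | x in A] V <= cov A V)%N.
Proof.
by move=> An; apply: covering_number_le; apply: covered_lcoset;
  exact: covering_numberP An.
Qed.

Lemma covering_number_lcoset g A V n : covered A V n ->
  cov [set (g * x)%g | x in A] V = cov A V.
Proof.
move=> An; apply/eqP; rewrite eqn_leq (covering_number_lcoset_le g An)/=.
have := covering_number_lcoset_le g^-1%g (covered_lcoset g An).
by rewrite lcosetK.
Qed.

Lemma covering_numberM A K V m n : covered A K m -> covered K V n ->
  (cov A V <= cov A K * cov K V)%N.
Proof.
move=> /covering_numberP[s sm As] /covering_numberP[t tn Kt].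
apply: covering_number_le; exists [seq (g * k)%g | g <- s, k <- t].
  by rewrite size_allpairs leq_mul.
move=> x /As[g /= gs [y /Kt[k /= kt [z Vz <-]] <-]].
exists (g * k)%g; first exact: allpairs_f.
by exists z => //; rewrite mulgA.
Qed.

Lemma covering_number_gt0 A V n : covered A V n -> A !=set0 -> (0 < cov A V)%N.
Proof.
move=> /covering_numberP[s sn As] [x Ax]; apply: leq_trans sn.
by have [g] := As x Ax; case: s {As}.
Qed.

End covering_number.

Section haar_content.
Local Open Scope ring_scope.
Variables (R : realType) (G : topologicalGroupType).
Hypothesis hG : hausdorff_space G.
Variable K0 : set G.
Hypotheses (cK0 : compact K0) (K0nbhs : nbhs 1%g K0).
Variable U : set_system (set G).
Hypotheses (UU : UltraFilter U) (UF : powerset_filter_from (nbhs (1%g : G)) `<=` U).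

Definition covering_ratio (K V : set G) : R :=
  (covering_number K V)%:R / (covering_number K0 V)%:R.

(** Any [U] as above concentrates on arbitrarily small neighborhoods of [1], so
    that this is a limit of the ratios as [V] shrinks to [1]; it exists because
    the ratios stay bounded for a compact [K]. *)
Definition haar_content (K : set G) : R := lim (covering_ratio K @ U).

Local Notation h := haar_content.

Lemma covering_ratio_ge0 K V : 0 <= covering_ratio K V.
Proof. by rewrite divr_ge0. Qed.

Lemma covering_ratio_bounded K V : compact K ->
  `|covering_ratio K V| <= (covering_number K K0)%:R.
Proof.
move=> cK; rewrite ger0_norm ?covering_ratio_ge0//.
have [[n K0n]|nK0] := pselect (exists n, covered K0 V n); last first.
  rewrite /covering_ratio {2}/covering_number; case: pselect => [p|_].
    by have [n /asboolP K0n] := p; case: nK0; exists n.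
  by rewrite invr0 mulr0.
have [m Km] := compact_covered cK K0nbhs.
rewrite ler_pdivrMr; last first.
  rewrite ltr0n; apply: covering_number_gt0 K0n _.
  by exists 1%g; exact: nbhs_singleton.
by rewrite -natrM ler_nat; exact: covering_numberM Km K0n.
Qed.

Lemma cvg_covering_ratio K : compact K -> covering_ratio K @ U --> h K.
Proof.
move=> cK.
exact: (@ultra_bounded_cvg _ _ _ UU _ _ (fun V => covering_ratio_bounded V cK)).
Qed.

Let UP : ProperFilter U. Proof. exact: ultra_proper. Qed.

Lemma near_nbhs1 : \forall V \near U, nbhs (1%g : G) V.
Proof. by apply: UF; exact: near_small_set. Qed.

Lemma haar_content_ge0 K : compact K -> 0 <= h K.
Proof.
move=> cK; apply: (limr_ge (F := U)) (cvg_covering_ratio cK) _.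
by apply: nearW => V; exact: covering_ratio_ge0.
Qed.

Lemma haar_contentS K L : compact K -> compact L -> K `<=` L -> h K <= h L.
Proof.
move=> cK cL KL; apply: (le_cvg_along UP) (cvg_covering_ratio cK) (cvg_covering_ratio cL) _.
apply: filterS near_nbhs1 => V nV; have [n Ln] := compact_covered cL nV.
by rewrite ler_pM// ?invr_ge0// ler_nat; exact: covering_numberS Ln.
Qed.

Lemma haar_contentU K L : compact K -> compact L -> h (K `|` L) <= h K + h L.
Proof.
move=> cK cL; apply: (le_cvg_along UP) (cvg_covering_ratio (compactU cK cL))
  (cvgD (cvg_covering_ratio cK) (cvg_covering_ratio cL)) _.
apply: filterS near_nbhs1 => V nV.
have [n Ln] := compact_covered cL nV; have [m Km] := compact_covered cK nV.
suff : covering_ratio (K `|` L) V <= covering_ratio K V + covering_ratio L V by [].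
rewrite /= /covering_ratio -mulrDl ler_wpM2r ?invr_ge0// -natrD ler_nat.
exact: covering_numberU Km Ln.
Qed.

(** The set [K^-1 L] is compact and misses [1], so that a translate of a small
    neighborhood of [1] cannot meet both [K] and [L]. *)
Lemma near_disjoint_translates K L : compact K -> compact L -> K `&` L = set0 ->
  \forall V \near U, forall g x y, V x -> V y -> K (g * x)%g -> L (g * y)%g -> False.
Proof.
move=> cK cL KL.
pose q (p : G * G) : G := (p.1^-1 * p.2)%g.
have qc : continuous q.
  apply: continuous_mulg; last by apply: continuous_snd_comp; exact: continuous_idfun.
  by apply: continuous_invg; apply: continuous_fst_comp; exact: continuous_idfun.
have cq : closed (q @` (K `*` L)).
  apply: compact_closed => //; apply: continuous_compact.
    exact: continuous_subspaceT.
  exact: compact_setX.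
have q1 : nbhs (1%g : G) (~` (q @` (K `*` L))).
  apply: open_nbhs_nbhs; split; first exact: closed_openC.
  move=> [[k l] /= [Kk Ll] kl1]; suff : (K `&` L) k by rewrite KL.
  split=> //; suff -> : k = l by [].
  by apply/esym; rewrite -[l](mulVKg k) -[(k^-1 * l)%g]/(q (k, l)) kl1 mulg1.
have q11 : nbhs (q (1%g, 1%g)) (~` (q @` (K `*` L))) by rewrite {1}/q /= invg1 mulg1.
have [[W1 W2] /= [nW1 nW2] W12] := qc (1%g, 1%g) _ q11.
apply: UF; apply: filterS (small_set_sub (filterI nW1 nW2)) => V VW g x y Vx Vy Kx Ly.
apply: (W12 (x, y)); first by split; [exact: (VW _ Vx).1|exact: (VW _ Vy).2].
exists ((g * x)%g, (g * y)%g) => //.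
by rewrite /q /= invgM mulgA mulgVK.
Qed.

(** Covering numbers are only subadditive; additivity on disjoint compact sets
    appears in the limit. *)
Lemma haar_content_disjoint K L : compact K -> compact L -> K `&` L = set0 ->
  h K + h L <= h (K `|` L).
Proof.
move=> cK cL KL; apply: (le_cvg_along UP)
  (cvgD (cvg_covering_ratio cK) (cvg_covering_ratio cL))
  (cvg_covering_ratio (compactU cK cL)) _.
have sepKL := near_disjoint_translates cK cL KL.
apply: filterS2 near_nbhs1 sepKL => V nV sep.
have [n KLn] := compact_covered (compactU cK cL) nV.
suff : covering_ratio K V + covering_ratio L V <= covering_ratio (K `|` L) V by [].
rewrite /= /covering_ratio -mulrDl ler_wpM2r ?invr_ge0// -natrD ler_nat.
exact: covering_number_disjoint KLn sep.
Qed.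

Lemma haar_content_lcoset g K : compact K -> h [set (g * x)%g | x in K] = h K.
Proof.
move=> cK; apply: (cvg_lim (@Rhausdorff R)).
apply: cvg_trans (cvg_covering_ratio cK); apply: near_eq_cvg.
apply: filterS near_nbhs1 => V nV; have [n Kn] := compact_covered cK nV.
by rewrite /covering_ratio (covering_number_lcoset _ Kn).
Qed.

Lemma haar_content_ref : h K0 = 1.
Proof.
apply: (cvg_lim (@Rhausdorff R)).
apply: cvg_trans (@cvg_cst R 1 (set G) U _); apply: near_eq_cvg.
apply: filterS near_nbhs1 => V nV; have [n Kn] := compact_covered cK0 nV.
rewrite /covering_ratio divff// pnatr_eq0 -lt0n.
by apply: covering_number_gt0 Kn _; exists 1%g; exact: nbhs_singleton.
Qed.

End haar_content.

(** * From a content to a Borel measure *)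

Lemma borel_open (T : ptopologicalType) (A : set T) :
  open A -> measurable (A : set (borel T)).
Proof. by move=> oA; exact: sub_sigma_algebra. Qed.

Lemma borel_closed (T : ptopologicalType) (A : set T) :
  closed A -> measurable (A : set (borel T)).
Proof.
by move=> cA; rewrite -[A]setCK; apply: measurableC; apply: borel_open;
  exact: closed_openC.
Qed.

Lemma continuous_borel (T T' : ptopologicalType) (f : T -> T') :
  continuous f -> measurable_fun setT (f : borel T -> borel T').
Proof.
move=> cf; apply: (@measurability _ _ (borel T) (borel T') setT f (@open T')) => //.
move=> _ [A oA <-]; rewrite setTI; apply: borel_open.
by apply: open_comp => // x _; exact: cf.
Qed.

Section content_measure.
Local Open Scope ereal_scope.
Variables (R : realType) (T : ptopologicalType) (B : nat -> set T).
Hypotheses (hT : hausdorff_space T) (bB : compact_basis B).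
Variable h : set T -> R.
Hypotheses (h_ge0 : forall K, compact K -> (0 <= h K)%R)
  (hS : forall K L, compact K -> compact L -> K `<=` L -> (h K <= h L)%R)
  (hU : forall K L, compact K -> compact L -> (h (K `|` L) <= h K + h L)%R)
  (h_disj : forall K L, compact K -> compact L -> K `&` L = set0 ->
     (h K + h L <= h (K `|` L))%R).

Definition inner_content (O : set T) : \bar R :=
  ereal_sup [set (h K)%:E | K in [set K | compact K /\ K `<=` O]].

(** With the value [+oo] off the open sets, the outer measure generated by the
    gauge is computed on coverings by open sets. *)
Definition open_gauge (A : set (borel T)) : \bar R :=
  if `[< open (A : set T) >] then inner_content A else +oo.

Local Notation lam := inner_content.
Local Notation mu := (mu_ext open_gauge).

Let h0 : h set0 = 0%R.
Proof.
apply/eqP; rewrite eq_le h_ge0 ?andbT; last exact: compact0.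
have := h_disj compact0 compact0 (setI0 _); rewrite setU0.
by rewrite gerDl.
Qed.

Lemma inner_content_ub O K : compact K -> K `<=` O -> (h K)%:E <= lam O.
Proof. by move=> cK KO; apply: ereal_sup_ubound; exists K. Qed.

Lemma inner_content_ge0 O : 0 <= lam O.
Proof. by have := inner_content_ub compact0 (@sub0set _ O); rewrite h0. Qed.

Lemma inner_content0 : lam set0 = 0.
Proof.
apply/eqP; rewrite eq_le inner_content_ge0 andbT.
by apply: ge_ereal_sup => _ [K [cK KO] <-]; move: KO; rewrite subset0 => ->; rewrite h0.
Qed.

Lemma open_gaugeE O : open O -> open_gauge O = lam O.
Proof. by move=> oO; rewrite /open_gauge; case: asboolP. Qed.

Lemma open_gauge0 : open_gauge set0 = 0.
Proof. by rewrite open_gaugeE ?inner_content0//; exact: open0. Qed.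

Lemma open_gauge_ge0 A : 0 <= open_gauge A.
Proof.
by rewrite /open_gauge; case: asboolP => // _; exact: inner_content_ge0.
Qed.

Let outer : outer_measure R T :=
  HB.pack (mu : set T -> \bar R) (isOuterMeasure.Build R T mu
    (mu_ext0 open_gauge0 open_gauge_ge0) (mu_ext_ge0 open_gauge_ge0)
    (@le_mu_ext _ _ _ open_gauge) (mu_ext_sigma_subadditive open_gauge_ge0)).

(** Cut [K] into compact pieces, one in each of the open sets. *)
Lemma content_le_sum (K : set T) (O : nat -> set T) n : compact K ->
  (forall i, open (O i)) -> K `<=` \bigcup_(i < n) O i ->
  (h K)%:E <= \sum_(i < n) lam (O i).
Proof.
move=> + oO; elim: n K => [|n ih] K cK.
  by rewrite bigcup_mkord big_ord0 subset0 => ->; rewrite h0 big_ord0.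
rewrite bigcup_mkord big_ord_recr/= -bigcup_mkord => KO.
have [|K1 [K2 [cK1 cK2 K1O K2O KE]]] := compact_split hT bB cK _ (oO n) KO.
  by apply: bigcup_open.
rewrite big_ord_recr/= KE; apply: (@le_trans _ _ ((h K1)%:E + (h K2)%:E)).
  by rewrite -EFinD lee_fin hU.
by apply: leeD; [exact: ih|exact: inner_content_ub].
Qed.

Lemma content_le_mu_ext (K : set T) : compact K -> (h K)%:E <= mu K.
Proof.
move=> cK; apply: le_ereal_inf_tmp => _ [F [mF KF] <-].
have [oF|] := pselect (forall i, open (F i : set T)); last first.
  move=> /existsNP[i nFi]; rewrite (@eseries_pinfty _ _ _ i) ?leey//.
    by move=> n _; rewrite -ltNye; apply: lt_le_trans (open_gauge_ge0 _).
  by rewrite /open_gauge; case: asboolP.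
move: (cK); rewrite compact_cover => /(_ nat setT F (fun i _ => oF i) KF)[D _ KD].
pose n := (\max_(i <- D) i).+1.
apply: (@le_trans _ _ (\sum_(i < n) lam (F i))).
  apply: content_le_sum => // x /KD[i /= iD Fix]; exists i => //=.
  by rewrite /n ltnS; exact: leq_bigmax_seq.
under eq_bigr => i _ do rewrite -(open_gaugeE (oF i)).
rewrite -(big_mkord xpredT (fun i => open_gauge (F i))).
by apply: nneseries_lim_ge => i _ _; exact: open_gauge_ge0.
Qed.

Lemma mu_ext_le_inner (A O : set T) : open O -> A `<=` O -> mu A <= lam O.
Proof.
move=> oO AO; apply: (@le_trans _ _ (mu O)); first exact: le_mu_ext.
apply: ereal_inf_lbound; exists (fun i => if i is 0%N then O else set0).
  split; last by move=> x Ox; exists 0%N.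
  by case=> [|i]; [exact: borel_open|exact: measurable0].
rewrite nneseries_recl //; last by move=> i _; exact: open_gauge_ge0.
rewrite open_gaugeE// eseries_cond/= eseries0 ?adde0// => -[|i]//= _ _.
exact: open_gauge0.
Qed.

Lemma mu_ext_compact_lty (K : set T) : compact K -> mu K < +oo.
Proof.
move=> cK; have [W [oW KW _ cW]] := compact_shrink bB cK openT (@subsetT _ _).
apply: (le_lt_trans (mu_ext_le_inner oW KW)); apply: (@le_lt_trans _ _ (h (closure W))%:E).
  apply: ge_ereal_sup => _ [L [cL LW] <-]; rewrite lee_fin hS//.
  exact: subset_trans (@subset_closure _ _).
exact: ltry.
Qed.

(** Fill the part of [W] inside [U] with a compact set [K] of almost full
    content; the other part lies in the open set [W] minus [K], and a compact
    subset of this set is disjoint from [K]. *)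
Lemma inner_content_split (U W : set T) : open U -> open W ->
  mu (W `&` U) + mu (W `&` ~` U) <= lam W.
Proof.
move=> oU oW; have := inner_content_ge0 W.
case E : (lam W) => [w| |] // _; last by rewrite leey.
apply: (@le_trans _ _ (lam (W `&` U) + mu (W `&` ~` U))).
  by apply: leeD2r; apply: mu_ext_le_inner => //; exact: openI.
have muge0 := mu_ext_ge0 open_gauge_ge0.
have H K : compact K -> K `<=` W `&` U -> mu (W `&` ~` U) <= (w - h K)%:E.
  move=> cK KWU; apply: (@le_trans _ _ (lam (W `\` K))).
    apply: mu_ext_le_inner; last by move=> x [Wx Ux]; split=> // /KWU[].
    by apply: openI => //; apply: closed_openC; exact: compact_closed.
  apply: ge_ereal_sup => _ [L [cL LWK] <-].
  rewrite lee_fin lerBrDr addrC -lee_fin -E.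
  apply: le_trans (inner_content_ub (compactU cK cL) _); last first.
    by move=> x [/KWU[]//|/LWK[]].
  rewrite lee_fin h_disj//; apply/seteqP; split=> // x [Kx /LWK[]//].
have mufin : mu (W `&` ~` U) \is a fin_num.
  rewrite ge0_fin_numE//; apply: le_lt_trans (H set0 _ _) _ => //.
    exact: compact0.
  exact: ltry.
rewrite -leeBrDr//; apply: ge_ereal_sup => _ [K [cK KWU] <-].
by rewrite leeBrDr// addeC -leeBrDr// -EFinB; exact: H.
Qed.

(** A general set may be replaced by the open sets that cover it, for which the
    splitting is known. *)
Lemma open_caratheodory (U : set T) : open U -> mu.-caratheodory U.
Proof.
move=> oU; apply: (@le_caratheodory_measurable _ _ outer) => X /=.
apply: le_ereal_inf_tmp => _ [F [mF XF] <-].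
have muge0 := mu_ext_ge0 open_gauge_ge0.
apply: (@le_trans _ _ (\sum_(i <oo) (mu (F i `&` U) + mu (F i `&` ~` U)))); last first.
  apply: lee_nneseries => [i _ _|i _]; first by rewrite adde_ge0.
  rewrite /open_gauge; case: asboolP => [oF|_]; last exact: leey.
  exact: inner_content_split.
rewrite nneseriesD => [|i _ _|i _ _]; [|exact: muge0|exact: muge0].
have H V : mu (X `&` V) <= \sum_(i <oo) mu (F i `&` V).
  apply: (@le_trans _ _ (mu (\bigcup_i (F i `&` V)))).
    by apply: le_mu_ext; rewrite -setI_bigcupl; exact: setSI.
  exact: mu_ext_sigma_subadditive open_gauge_ge0 _.
exact: leeD.
Qed.

(** The open sets satisfy the criterion of Caratheodory, hence so do the Borel
    sets, on which the outer measure is therefore countably additive. *)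
Theorem content_measure : exists m : {measure set (borel T) -> \bar R},
  forall A, m A = mu A.
Proof.
have sub : (@measurable _ (borel T) : set (set T)) `<=`
    (@measurable _ (caratheodory_type outer)).
  apply: (@smallest_sub _ _ (@open T : set (set T))
    (@measurable _ (caratheodory_type outer))).
    exact: (@sigma_algebra_measurable _ (caratheodory_type outer)).
  by move=> U oU; exact: open_caratheodory.
have mu0 : (mu : set (borel T) -> \bar R) set0 = 0 by exact: (outer_measure0 outer).
have mu_ge0 A : 0 <= (mu : set (borel T) -> \bar R) A by exact: (outer_measure_ge0 outer).
have mu_sa : semi_sigma_additive (mu : set (borel T) -> \bar R).
  move=> A mA tA mbA; apply: (@caratheodory_measure_sigma_additive _ _ outer) => //.
    by move=> i; exact: sub.
  exact: sub.
pose m : {measure set (borel T) -> \bar R} := HB.pack (mu : set (borel T) -> \bar R)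
  (isMeasure.Build _ _ _ (mu : set (borel T) -> \bar R) mu0 mu_ge0 mu_sa).
by exists m.
Qed.

End content_measure.

(** * Haar measure *)

Lemma lcoset_measurable (G : topologicalGroupType) (g : G) (A : set (borel G)) :
  measurable A -> measurable ([set (g * x)%g | x in A] : set (borel G)).
Proof.
move=> mA; rewrite lcosetE.
have /(_ measurableT A mA) := continuous_borel (@lmulg_continuous G g^-1%g).
by rewrite setTI.
Qed.

(** The limit of the covering ratios is a translation-invariant content, equal to
    [1] on a neighborhood of [1]; the measure that it generates inherits these
    properties. *)
Theorem haar_exists (R : realType) (G : topologicalGroupType) : lcsc G ->
  exists mu : {measure set (borel G) -> \bar R}, left_haar mu.
Proof.
move=> [hG lG sG]; have [B bB] := lcsc_compact_basis hG lG sG.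
have [b1 b2 b3] := bB.
have [i0 Bi1 _] := b3 (1%g : G) setT filterT.
pose K0 := closure (B i0).
have K01 : nbhs (1%g : G) K0.
  by apply: filterS (open_nbhs_nbhs (conj (b1 i0) Bi1)); exact: subset_closure.
have [U [UU UF]] := ultraFilterLemma (powerset_filter_from_filter (nbhs_pfilter (1%g : G))).
pose h := @haar_content R G K0 U.
have h_ge0 K : compact K -> 0 <= h K by exact: haar_content_ge0.
have hS K L : compact K -> compact L -> K `<=` L -> h K <= h L by exact: haar_contentS.
have hU K L : compact K -> compact L -> h (K `|` L) <= h K + h L by exact: haar_contentU.
have hd K L : compact K -> compact L -> K `&` L = set0 -> h K + h L <= h (K `|` L).
  exact: haar_content_disjoint.
have [mu muE] := content_measure hG h_ge0 hd.
exists mu; split.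
- apply/eqP => mu0.
  have := content_le_mu_ext hG bB h_ge0 hU hd (b2 i0).
  rewrite -muE leNgt => /negP; apply.
  have -> : h (closure (B i0)) = 1 by exact: (haar_content_ref R (b2 i0) K01 UU UF).
  apply: (@le_lt_trans _ _ 0%E); last by rewrite lte_fin.
  rewrite -mu0; apply: le_measure; rewrite ?inE //.
  by apply: borel_closed; exact: closed_closure.
- by move=> C cC; rewrite muE; exact: mu_ext_compact_lty.
have inv O g : open O -> inner_content h [set (g * x)%g | x in O] = inner_content h O.
  suff H g' O' : (inner_content h [set (g' * x)%g | x in O'] <= inner_content h O')%E.
    move=> oO; apply/eqP; rewrite eq_le H/=.
    have := H g^-1%g [set (g * x)%g | x in O].
    by rewrite lcosetK.
  apply: ge_ereal_sup => _ [K [cK KO] <-].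
  have -> : h K = h [set (g'^-1 * x)%g | x in K] by rewrite /h haar_content_lcoset.
  apply: inner_content_ub; first exact: lcoset_compact.
  by move=> _ [x /KO[y Oy <-] <-]; rewrite mulKg.
suff H (g : G) (A : set (borel G)) : measurable A -> (mu [set (g * x)%g | x in A] <= mu A)%E.
  move=> g A mA; apply/eqP; rewrite eq_le H//=.
  have := H g^-1%g [set (g * x)%g | x in A] (lcoset_measurable g mA).
  by rewrite lcosetK.
move=> mA; rewrite !muE.
apply: le_ereal_inf_tmp => _ [F [mF AF] <-].
apply: ereal_inf_lbound; exists (fun i => [set (g * x)%g | x in F i]).
  split; first by move=> i; exact: lcoset_measurable.
  by move=> _ [x /AF[i _ Fix] <-]; exists i => //; exists x.
apply: eq_eseriesr => i _; rewrite /open_gauge.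
case: asboolP => [ogF|nogF]; case: asboolP => [oF|noF] //.
- exact: inv.
- by case: noF; have := lcoset_open g^-1%g ogF; rewrite lcosetK.
- by case: nogF; exact: lcoset_open.
Qed.

Section haar_translation.
Local Open Scope ereal_scope.
Variables (R : realType) (G : topologicalGroupType).
Hypothesis lcscG : lcsc G.
Variable mu : {measure set (borel G) -> \bar R}.
Hypothesis haar_mu : left_haar mu.

Let hG : hausdorff_space G. Proof. by case: lcscG. Qed.

Lemma haar_compact_lty (K : set G) : compact K -> mu K < +oo.
Proof. by case: haar_mu => _ + _; apply. Qed.

Lemma haar_lcoset (g : G) (A : set (borel G)) : measurable A ->
  mu [set (g * x)%g | x in A] = mu A.
Proof. by case: haar_mu => _ _; apply. Qed.

(** Removing from an open set of finite measure the closures of the basic sets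
    that miss [K], one after the other, leaves a decreasing sequence of open sets
    with intersection [K]. *)
Lemma haar_outer_regular (K : set G) (e : R) : compact K -> (0 < e)%R ->
  exists2 W : set G, open W /\ K `<=` W & mu (W `\` K) < e%:E.
Proof.
move=> cK e0; have [h1 lG sG] := lcscG; have [B bB] := lcsc_compact_basis h1 lG sG.
have [W0 [oW0 KW0 _ cW0]] := compact_shrink bB cK openT (@subsetT _ _).
have clK := compact_closed hG cK.
pose C i := if `[< closure (B i) `<=` ~` K >] then ~` closure (B i) else setT.
have oC i : open (C i).
  by rewrite /C; case: ifP => _; [exact/closed_openC/closed_closure|exact: openT].
pose F := fix F n := if n is n'.+1 then F n' `&` C n' else W0.
have oF n : open (F n) by elim: n => [//|n ih] /=; exact: openI.
have KF n : K `<=` F n.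
  elim: n => [//|n ih] x Kx /=; split; first exact: ih.
  by rewrite /C; case: asboolP => // BK clBx; exact: BK Kx.
have FE : \bigcap_n (F n `\` K) = set0.
  apply/seteqP; split=> // x Fx; have [_ nKx] := Fx 0%N I.
  have oKC : open (~` K) by exact: closed_openC.
  have [_ _ b3] := bB.
  have [i Bix BiK] := b3 x (~` K) (open_nbhs_nbhs (conj oKC nKx)).
  have [] := Fx i.+1 I => -[_]; rewrite /C; case: asboolP => //= _ [].
  exact: subset_closure.
have mF n : measurable (F n `\` K : set (borel G)).
  by apply: measurableD; [exact: borel_open|exact: borel_closed].
have : mu \o (fun n => F n `\` K) @ \oo --> mu (\bigcap_n (F n `\` K)).
  apply: nonincreasing_cvg_mu => //.
  - apply: le_lt_trans (haar_compact_lty cW0); apply: le_measure; rewrite ?inE//.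
      by apply: borel_closed; exact: closed_closure.
    by move=> x [Wx _]; exact: subset_closure.
  - by rewrite FE.
  - apply/nonincreasing_seqP => n; apply/subsetPset => x [] /= [Fx _] nKx.
    by split.
have p : nbhs (0 : \bar R) [set x | x < e%:E].
  by apply: open_ereal_lt'; rewrite lte_fin.
rewrite FE measure0 => /(_ _ p)[n _ /(_ n (leqnn n)) Fn].
by exists (F n).
Qed.

Lemma haar_measureD_sym (A A' : set (borel G)) : measurable A -> measurable A' ->
  mu A < +oo -> mu A = mu A' -> mu (A `\` A') = mu (A' `\` A).
Proof.
move=> mA mA' foo AA'; have foo' : mu A' < +oo by rewrite -AA'.
by rewrite (measureD mA mA' foo) (measureD mA' mA foo') (setIC A'); congr (_ - _).
Qed.

(** For [k'] near [k] the set [k' K] lies in an open set hardly larger than [k K],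
    which bounds one difference; the other one has the same measure, as both
    translates have the measure of [K]. *)
Lemma haar_translation_continuous (K : set G) (k : G) (e : R) :
  compact K -> (0 < e)%R ->
  \forall k' \near k,
    mu ([set (k * x)%g | x in K] `\` [set (k' * x)%g | x in K]) < e%:E /\
    mu ([set (k' * x)%g | x in K] `\` [set (k * x)%g | x in K]) < e%:E.
Proof.
move=> cK e0.
have mK (g : G) : measurable ([set (g * x)%g | x in K] : set (borel G)).
  by apply: borel_closed; apply: compact_closed => //; exact: lcoset_compact.
have muK (g : G) : mu [set (g * x)%g | x in K] = mu K.
  by apply: haar_lcoset; apply: borel_closed; exact: compact_closed.
have [W [oW kKW] We] := haar_outer_regular (@lcoset_compact G k K cK) e0.
have : \forall k' \near k, K `<=` [set x | W (k' * x)%g].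
  move: cK => /compact_near_coveringP/(_ _ (nbhs k) (fun k' x => W (k' * x)%g)).
  apply => x Kx; have nW : nbhs (k * x)%g W.
    by apply: open_nbhs_nbhs; split=> //; apply: kKW; exists x.
  have [[V1 V2] /= [n1 n2] V12] := @mulg_continuous G (k, x) _ nW.
  by exists (V2, V1) => //= -[x' k'] /= [V2x V1k]; exact: (V12 (k', x')).
apply: filterS => k' k'K.
suff H : mu ([set (k' * x)%g | x in K] `\` [set (k * x)%g | x in K]) < e%:E.
  split=> //; rewrite haar_measureD_sym// ?muK ?haar_compact_lty//.
apply: le_lt_trans We; apply: le_measure; rewrite ?inE//.
- exact: measurableD.
- by apply: measurableD => //; exact: borel_open.
- by move=> _ [[x Kx <-]] nk; split=> //; exact: k'K.
Qed.

End haar_translation.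

(** * Bounded measurable functions *)

Definition bounded_by (T : Type) (R : realType) (C : R) (f : T -> R) :=
  forall x, `|f x| <= C.

(** The means of the walk only involve integrals of bounded functions against
    probabilities, for which integrability is automatic and the integral is real
    valued. *)
Definition bounded_measurable d (T : measurableType d) (R : realType)
    (f : T -> R) := measurable_fun setT f /\ exists C, bounded_by C f.

Section bounded_measurable.
Context d (T : measurableType d) (R : realType).
Implicit Types (f g : T -> R) (P : probability T R).
Local Notation bm := (@bounded_measurable d T R).

Lemma bm_cst c : bm (fun=> c).
Proof. by split; [exact: measurable_cst|exists `|c| => x]. Qed.

Lemma bmD f g : bm f -> bm g -> bm (fun x => f x + g x).
Proof.
move=> [mf [C fC]] [mg [D gD]]; split; first exact: measurable_funD.
by exists (C + D) => x; rewrite (le_trans (ler_normD _ _))// lerD.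
Qed.

Lemma bmM f g : bm f -> bm g -> bm (fun x => f x * g x).
Proof.
move=> [mf [C fC]] [mg [D gD]]; split; first exact: measurable_funM.
by exists (C * D) => x; rewrite normrM ler_pM.
Qed.

Lemma bmZ c f : bm f -> bm (fun x => c * f x).
Proof. by apply: bmM; exact: bm_cst. Qed.

Lemma bmB f g : bm f -> bm g -> bm (fun x => f x - g x).
Proof.
move=> [mf [C fC]] [mg [D gD]]; split; first exact: measurable_funB.
by exists (C + D) => x; rewrite (le_trans (ler_normB _ _))// lerD.
Qed.

Lemma bm_norm f : bm f -> bm (fun x => `|f x|).
Proof.
move=> [mf [C fC]]; split; first by apply: measurableT_comp.
by exists C => x; rewrite normr_id.
Qed.

Lemma bm_sum (I : Type) (s : seq I) (F : I -> T -> R) :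
  (forall i, bm (F i)) -> bm (fun x => \sum_(i <- s) F i x).
Proof.
move=> bF; elim: s => [|i s ih].
  by rewrite (_ : (fun _ => _) = fun=> 0); [exact: bm_cst|apply/funext => x; rewrite big_nil].
rewrite (_ : (fun _ => _) = fun x => F i x + \sum_(j <- s) F j x).
  exact: bmD.
by apply/funext => x; rewrite big_cons.
Qed.

Lemma bm_comp d' (S : measurableType d') (u : S -> T) f :
  measurable_fun setT u -> bm f -> bounded_measurable (fun x => f (u x)).
Proof.
move=> mu [mf [C fC]]; split; first exact: measurableT_comp.
by exists C => x.
Qed.

Lemma bm_integrable P f : bm f -> P.-integrable setT (EFin \o f).
Proof.
move=> [mf [C fC]]; apply: (@le_integrable _ _ _ _ _ _ _ (EFin \o cst C)) => //.
- exact/measurable_EFinP.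
- by move=> x _ /=; rewrite lee_fin (le_trans (fC x))// ler_norm.
exact: finite_measure_integrable_cst.
Qed.

Lemma bm_EFin_integral P f : bm f ->
  (\int[P]_x f x)%:E = (\int[P]_x (f x)%:E)%E.
Proof.
move=> bf; rewrite /Rintegral fineK//.
exact: (integrable_fin_num measurableT (bm_integrable P bf)).
Qed.

Lemma bm_integralD P f g : bm f -> bm g ->
  \int[P]_x (f x + g x) = \int[P]_x f x + \int[P]_x g x.
Proof. by move=> bf bg; apply: RintegralD => //; exact: bm_integrable. Qed.

Lemma bm_integralB P f g : bm f -> bm g ->
  \int[P]_x (f x - g x) = \int[P]_x f x - \int[P]_x g x.
Proof. by move=> bf bg; apply: RintegralB => //; exact: bm_integrable. Qed.

Lemma bm_integralZ P c f : bm f -> \int[P]_x (c * f x) = c * \int[P]_x f x.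
Proof. by move=> bf; apply: RintegralZl => //; exact: bm_integrable. Qed.

Lemma integral_prob_cst P (c : R) : \int[P]_(x in setT) c = c.
Proof. by rewrite Rintegral_cst//= probability_setT mulr1. Qed.

Lemma bm_integral_sum P (I : Type) (s : seq I) (F : I -> T -> R) :
  (forall i, bm (F i)) ->
  \int[P]_x (\sum_(i <- s) F i x) = \sum_(i <- s) \int[P]_x F i x.
Proof.
move=> bF; elim: s => [|i s ih].
  by under eq_Rintegral do rewrite big_nil; rewrite integral_prob_cst big_nil.
under eq_Rintegral do rewrite big_cons.
by rewrite bm_integralD ?ih ?big_cons//; exact: bm_sum.
Qed.

Lemma le_bm_integral P f g : bm f -> bm g -> (forall x, f x <= g x) ->
  \int[P]_x f x <= \int[P]_x g x.
Proof. by move=> bf bg fg; apply: le_Rintegral => //; exact: bm_integrable. Qed.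

Lemma bm_integral_bounded P C f : measurable_fun setT f -> bounded_by C f ->
  `|\int[P]_x f x| <= C.
Proof.
move=> mf fC; have bf : bm f by split=> //; exists C.
apply: le_trans (le_normr_Rintegral _ (bm_integrable P bf)) _ => //.
rewrite -[leRHS](integral_prob_cst P); apply: le_bm_integral => //.
- exact: bm_norm.
- exact: bm_cst.
Qed.

End bounded_measurable.

Section fubini_bm.
Context d d' (S : measurableType d) (T : measurableType d') (R : realType).
Variables (P : probability S R) (Q : probability T R).

Lemma bm_partial_integral (h : S * T -> R) : bounded_measurable h ->
  bounded_measurable (fun s => \int[Q]_t h (s, t)).
Proof.
(* Any probability on [S] serves here to view [h] as integrable on the product. *)
move=> bh; have ih := bm_integrable (\d_(point : S) \x Q)%E bh.
split; last first.
  case: bh => mh [C hC]; exists C => s; apply: bm_integral_bounded => //.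
  by apply: (measurableT_comp mh); exact: pair1_measurable.
apply: (measurableT_comp (f := fine)) => //.
exact: (measurable_fubini_F ih).
Qed.

Lemma bm_integral_prod (h : S * T -> R) : bounded_measurable h ->
  \int[(P \x Q)%E]_z h z = \int[P]_s \int[Q]_t h (s, t).
Proof.
move=> bh; have ih := bm_integrable (P \x Q)%E bh.
apply: EFin_inj; rewrite !bm_EFin_integral//; last exact: bm_partial_integral.
rewrite -(integral12_prod_meas1 ih); apply: eq_integral => s _.
by rewrite bm_EFin_integral//; apply: bm_comp bh; exact: pair1_measurable.
Qed.

Lemma bm_fubini (h : S * T -> R) : bounded_measurable h ->
  \int[P]_s \int[Q]_t h (s, t) = \int[Q]_t \int[P]_s h (s, t).
Proof.
move=> bh; have ih := bm_integrable (P \x Q)%E bh.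
rewrite -bm_integral_prod//.
have fE t : (\int[P]_s h (s, t))%:E = (\int[P]_s (h (s, t))%:E)%E.
  by rewrite bm_EFin_integral//; apply: bm_comp bh; exact: pair2_measurable.
rewrite /Rintegral -(integral21_prod_meas1 ih); congr fine.
by apply: eq_integral => t _; exact: (esym (fE t)).
Qed.

End fubini_bm.

(** * The random walk of a conjugation-invariant probability *)

Definition open_basis (T : topologicalType) (B : nat -> set T) :=
  (forall i, open (B i)) /\
  forall x W, nbhs x W -> exists2 i, B i x & B i `<=` W.

Lemma second_countable_open_basis (T : ptopologicalType) :
  @second_countable T -> exists B : nat -> set T, open_basis B.
Proof.
move=> [S cS [oS bS]]; have [f fS] := countable_seqP cS.
exists (fun n => if `[< open (f n) >] then f n else set0); split=> [n|x W xW].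
  by case: asboolP => // _; exact: open0.
have [U [SU Ux] UW] := bS x W xW; have [n _ fnU] := fS _ SU.
have oU := oS _ SU.
by exists n; case: asboolP; rewrite fnU.
Qed.

(** Second countability makes the product sigma-algebra contain all open sets, so
    that multiplication is jointly measurable. *)
Lemma prod_open_measurable (T T' : ptopologicalType) (A : set (T * T')) :
  @second_countable T -> @second_countable T' -> open A ->
  measurable (A : set (borel T * borel T')%type).
Proof.
move=> /second_countable_open_basis[B [oB bB]].
move=> /second_countable_open_basis[B' [oB' bB']] oA.
have -> : A = \bigcup_i \bigcup_j
    (if `[< B i `*` B' j `<=` A >] then B i `*` B' j else set0).
  apply/seteqP; split=> [[x y] Axy|z [i _ [j _]]]; last by case: asboolP => // sub; exact: sub.
  have [[V V'] /= [xV yV'] VA] : nbhs (x, y) A by exact: open_nbhs_nbhs.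
  have [i Bix BiV] := bB x V xV; have [j Bjy BjV'] := bB' y V' yV'.
  exists i => //; exists j => //; case: asboolP => // -[].
  by move=> [x' y'] [/= /BiV ? /BjV' ?]; apply: VA.
apply: bigcup_measurable => i _; apply: bigcup_measurable => j _.
case: ifP => _; last exact: measurable0.
by apply: measurableX; apply: borel_open.
Qed.

Lemma continuous2_borel (T T' T'' : ptopologicalType) (f : T * T' -> T'') :
  @second_countable T -> @second_countable T' -> continuous f ->
  measurable_fun setT (f : borel T * borel T' -> borel T'').
Proof.
move=> cT cT' cf; apply: (@measurability _ _ (borel T * borel T')%type
  (borel T'') setT f (@open T'')) => //.
move=> _ [A oA <-]; rewrite setTI; apply: prod_open_measurable => //.
by apply: open_comp => // x _; exact: cf.
Qed.

Section convolution.
Variables (R : realType) (G : topologicalGroupType).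
Hypothesis scG : @second_countable G.

Lemma mulg_measurable :
  measurable_fun setT (fun p : borel G * borel G => (p.1 * p.2)%g : borel G).
Proof. exact: (continuous2_borel scG scG (@mulg_continuous G)). Qed.

Definition mulg_mfun : {mfun (borel G * borel G)%type >-> borel G} :=
  HB.pack (fun p : borel G * borel G => (p.1 * p.2)%g : borel G)
    (isMeasurableFun.Build _ _ _ _ _ mulg_measurable).

Variable lam : probability (borel G) R.
Local Notation bm := (@bounded_measurable _ (borel G) R).

Definition convolution (th : probability (borel G) R) : probability (borel G) R :=
  distribution (lam \x th)%E mulg_mfun.

Definition averaging (f : borel G -> R) (x : borel G) : R :=
  \int[lam]_k f (k * x)%g.

Lemma bm_mulg f : bm f -> bounded_measurable (fun p : borel G * borel G => f (p.1 * p.2)%g).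
Proof. by move=> bf; exact: (bm_comp mulg_measurable). Qed.

Lemma lmul_measurable (g : G) :
  measurable_fun setT (fun x : borel G => (g * x)%g : borel G).
Proof. exact: continuous_borel (@lmulg_continuous G g). Qed.

Lemma rmul_measurable (g : G) :
  measurable_fun setT (fun x : borel G => (x * g)%g : borel G).
Proof. exact: continuous_borel (@rmulg_continuous G g). Qed.

Lemma bm_averaging f : bm f -> bm (averaging f).
Proof.
move=> bf; rewrite /averaging.
apply: (@bm_partial_integral _ _ (borel G) (borel G) R lam
  (fun p : borel G * borel G => f (p.2 * p.1)%g)).
apply: (bm_comp (u := fun p : borel G * borel G => (p.2, p.1)) _ (bm_mulg bf)).
exact: measurable_swap.
Qed.

Lemma integral_convolution th f : bm f ->
  \int[convolution th]_x f x = \int[th]_x averaging f x.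
Proof.
move=> bf; have bmf := bm_mulg bf.
transitivity (\int[(lam \x th)%E]_p f (p.1 * p.2)%g).
  rewrite /Rintegral; congr fine.
  have := @integral_pushforward _ _ _ _ R _ mulg_measurable (lam \x th)%E setT (EFin \o f).
  apply => //; first by apply/measurable_EFinP; exact: bf.1.
  exact: bm_integrable bmf.
rewrite (bm_integral_prod lam th bmf); exact: (bm_fubini lam th bmf).
Qed.

End convolution.

Section conjugation_invariant_walk.
Variables (R : realType) (G : topologicalGroupType).
Hypothesis scG : @second_countable G.
Variable lam : probability (borel G) R.
Hypothesis lam_conj : forall (g : G) (A : set (borel G)), measurable A ->
  lam ((fun x : borel G => (x ^ g)%g : borel G) @^-1` A) = lam A.
Variable th0 : probability (borel G) R.

Local Notation bm := (@bounded_measurable _ (borel G) R).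
Local Notation avg1 := (averaging lam).
Implicit Types (f w : borel G -> R) (C : R).

Lemma conj_measurable (g : G) :
  measurable_fun setT (fun x : borel G => (x ^ g)%g : borel G).
Proof. exact: continuous_borel (@conjg_continuous G g). Qed.

Lemma integral_conj f (g : G) : bm f ->
  \int[lam]_k f (k ^ g)%g = \int[lam]_k f k.
Proof.
move=> bf; have bfg : bm (fun k => f (k ^ g)%g).
  exact: (bm_comp (conj_measurable g)).
rewrite /Rintegral; congr fine.
have := @integral_pushforward _ _ _ _ R _ (conj_measurable g) lam setT (EFin \o f).
rewrite preimage_setT => H; rewrite -[LHS]H//.
- apply: eq_measure_integral => [|? A mA _]; [exact: (conj_measurable g)|exact: (lam_conj g mA)].
- by apply/measurable_EFinP; exact: bf.1.
- exact: bm_integrable bfg.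
Qed.

Lemma bm_lmul f (g : G) : bm f -> bm (fun x => f (g * x)%g).
Proof. by move=> bf; exact: (bm_comp (lmul_measurable g)). Qed.

(** Conjugation by [g] turns [k * (g * x)] into [g * (k * x)], and leaves [lam]
    invariant. *)
Lemma averaging_lmul f (g : G) : bm f ->
  avg1 (fun y => f (g * y)%g) = fun x => avg1 f (g * x)%g.
Proof.
move=> bf; apply/funext => x; rewrite /averaging.
have bF : bm (fun k => f (k * (g * x))%g).
  exact: (bm_comp (rmul_measurable (g * x)%g)).
rewrite -(integral_conj g^-1%g bF); apply: eq_Rintegral => k _.
by rewrite conjgE invgK !mulgA mulgVK.
Qed.

Lemma bm_iter_averaging m f : bm f -> bm (iter m avg1 f).
Proof. by move=> bf; elim: m => //= m ih; exact: bm_averaging. Qed.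

Lemma bounded_averaging C f : bm f -> bounded_by C f -> bounded_by C (avg1 f).
Proof.
move=> bf fC x; apply: bm_integral_bounded => [|k]; last exact: fC.
exact: (bm_comp (rmul_measurable x) bf).1.
Qed.

Lemma bounded_iter_averaging C m f : bm f -> bounded_by C f ->
  bounded_by C (iter m avg1 f).
Proof.
move=> bf fC; elim: m => //= m ih; apply: bounded_averaging => //.
exact: bm_iter_averaging.
Qed.

Lemma iter_averaging_lmul m f (g : G) : bm f ->
  iter m avg1 (fun y => f (g * y)%g) = fun x => iter m avg1 f (g * x)%g.
Proof.
move=> bf; elim: m => //= m ->; rewrite averaging_lmul//.
exact: bm_iter_averaging.
Qed.

(** The law, after [n] steps, of a random walk that starts with law [th0] and
    multiplies on the left by independent elements of law [lam]. *)
Fixpoint walk n : probability (borel G) R :=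
  if n is n'.+1 then convolution scG lam (walk n') else th0.

Lemma integral_walkS n f : bm f ->
  \int[walk n.+1]_x f x = \int[walk n]_x avg1 f x.
Proof. by move=> bf; rewrite /= integral_convolution. Qed.

Lemma integral_walk n f : bm f ->
  \int[walk n]_x f x = \int[th0]_x iter n avg1 f x.
Proof.
elim: n f => // n ih f bf; rewrite integral_walkS// ih ?iterSr//.
exact: bm_averaging.
Qed.

(** Two averagings are needed, with [N] much larger than [M]: the mean over [N]
    steps makes the functional nearly invariant under the averaging operator, the
    mean over [M] steps makes the function nearly invariant under it. *)
Definition walk_mean N f : R :=
  (\sum_(n < N.+1) \int[walk n]_x f x) / N.+1%:R.

Definition cesaro_mean M f : borel G -> R :=
  fun x => (\sum_(m < M.+1) iter m avg1 f x) / M.+1%:R.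

Local Notation L := walk_mean.

Lemma walk_meanD N f w : bm f -> bm w -> L N (fun x => f x + w x) = L N f + L N w.
Proof.
move=> bf bw; rewrite /walk_mean -mulrDl -big_split/=; congr (_ / _).
by apply: eq_bigr => n _; rewrite bm_integralD.
Qed.

Lemma walk_meanZ N c f : bm f -> L N (fun x => c * f x) = c * L N f.
Proof.
move=> bf; rewrite /walk_mean mulrA mulr_sumr; congr (_ / _).
by apply: eq_bigr => n _; rewrite bm_integralZ.
Qed.

Lemma walk_meanB N f w : bm f -> bm w -> L N (fun x => f x - w x) = L N f - L N w.
Proof.
move=> bf bw; rewrite /walk_mean -mulrBl -sumrB; congr (_ / _).
by apply: eq_bigr => n _; rewrite bm_integralB.
Qed.

Lemma walk_mean_cst N c : L N (fun=> c) = c.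
Proof.
rewrite /walk_mean (eq_bigr (fun=> c)); last by move=> n _; rewrite integral_prob_cst.
by rewrite sumr_const card_ord -(mulr_natr c) mulfK.
Qed.

Lemma le_walk_mean N f w : bm f -> bm w -> (forall x, f x <= w x) -> L N f <= L N w.
Proof.
move=> bf bw fw; rewrite ler_wpM2r ?invr_ge0//; apply: ler_sum => n _.
exact: le_bm_integral.
Qed.

Lemma walk_mean_bounded N C f : measurable_fun setT f -> bounded_by C f ->
  `|L N f| <= C.
Proof.
move=> mf fC; have bf : bm f by split=> //; exists C.
have fC' x : - C <= f x <= C by rewrite -ler_norml.
rewrite ler_norml; apply/andP; split.
  rewrite -[leLHS](walk_mean_cst N); apply: le_walk_mean => // [|x].
    exact: bm_cst.
  by have /andP[] := fC' x.
rewrite -[leRHS](walk_mean_cst N); apply: le_walk_mean => // [|x].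
  exact: bm_cst.
by have /andP[] := fC' x.
Qed.

Lemma walk_mean_sum N M (F : nat -> borel G -> R) : (forall m, bm (F m)) ->
  L N (fun x => \sum_(m < M) F m x) = \sum_(m < M) L N (F m).
Proof.
move=> bF; rewrite /walk_mean -mulr_suml exchange_big/=; congr (_ / _).
by apply: eq_bigr => n _; rewrite bm_integral_sum.
Qed.

(** Jensen's inequality, from the positivity of the mean of [(f x - l) ^+ 2] where
    [l] is the mean of [f]. *)
Lemma walk_mean_sqr N f : bm f -> L N f ^+ 2 <= L N (fun x => f x ^+ 2).
Proof.
move=> bf; set l := L N f; have bf2 : bm (fun x => f x ^+ 2) by exact: bmM.
have /(le_walk_mean N (bm_cst _ 0)) : bm (fun x => f x ^+ 2 - (2 * l * f x - l ^+ 2)).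
  by apply: bmB => //; apply: bmB; [exact: bmZ|exact: bm_cst].
rewrite walk_mean_cst.
have b1 : bm (fun x => 2 * l * f x - l ^+ 2) by apply: bmB; [exact: bmZ|exact: bm_cst].
rewrite walk_meanB// walk_meanB; [|exact: bmZ|exact: bm_cst].
rewrite walk_meanZ// walk_mean_cst -/l => H.
rewrite -subr_ge0; apply: le_trans (H _) _ => [x|]; last first.
  by rewrite le_eqVlt; apply/orP; left; apply/eqP; ring.
have -> : f x ^+ 2 - (2 * l * f x - l ^+ 2) = (f x - l) ^+ 2 by ring.
exact: sqr_ge0.
Qed.

(** Averaging shifts the walk by one step, so that the sum of the differences
    telescopes; likewise for [averaging_cesaro] below. *)
Lemma walk_mean_averaging N C f : bm f -> bounded_by C f ->
  `|L N (avg1 f) - L N f| <= 2 * C / N.+1%:R.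
Proof.
move=> bf fC; rewrite /walk_mean -mulrBl normrM [X in _ * X]ger0_norm ?invr_ge0//.
rewrite ler_wpM2r ?invr_ge0//.
rewrite -sumrB -(big_mkord xpredT (fun n => \int[walk n]_x avg1 f x - \int[walk n]_x f x)).
under eq_bigr => n _ do rewrite -integral_walkS//.
rewrite telescope_sumr// (le_trans (ler_normB _ _))// mulrDl !mul1r.
by apply: lerD; apply: bm_integral_bounded => //; exact: bf.1.
Qed.

Lemma walk_mean_iter N C m f : bm f -> bounded_by C f ->
  `|L N (iter m avg1 f) - L N f| <= m%:R * (2 * C / N.+1%:R).
Proof.
move=> bf fC; elim: m => [|m ih]; first by rewrite subrr normr0 mul0r.
rewrite -[X in `|X|](subrKA (L N (iter m avg1 f))) -natr1 mulrDl mul1r addrC.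
rewrite (le_trans (ler_normD _ _))// lerD//= ?walk_mean_averaging//.
  exact: bm_iter_averaging.
exact: bounded_iter_averaging.
Qed.

Lemma cesaro_lmul M f (g : G) : bm f ->
  cesaro_mean M (fun y => f (g * y)%g) = fun x => cesaro_mean M f (g * x)%g.
Proof.
move=> bf; apply/funext => x; rewrite /cesaro_mean; congr (_ / _).
by apply: eq_bigr => m _; rewrite iter_averaging_lmul.
Qed.

Lemma cesaroE M f : cesaro_mean M f =
  fun x => M.+1%:R^-1 * \sum_(m < M.+1) iter m avg1 f x.
Proof. by apply/funext => x; rewrite mulrC. Qed.

Lemma bm_cesaro M f : bm f -> bm (cesaro_mean M f).
Proof.
move=> bf; rewrite cesaroE; apply: bmZ; apply: bm_sum => m.
exact: bm_iter_averaging.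
Qed.

Lemma bounded_cesaro C M f : bm f -> bounded_by C f -> bounded_by C (cesaro_mean M f).
Proof.
move=> bf fC x; rewrite normrM [X in _ * X]ger0_norm ?invr_ge0//.
rewrite ler_pdivrMr// (le_trans (ler_norm_sum _ _ _))//.
apply: (@le_trans _ _ (\sum_(m < M.+1) C)).
  by apply: ler_sum => m _; exact: bounded_iter_averaging.
by rewrite sumr_const card_ord -(mulr_natr C).
Qed.

Lemma walk_mean_cesaro N M C f : bm f -> bounded_by C f ->
  `|L N (cesaro_mean M f) - L N f| <= M.+1%:R * (2 * C / N.+1%:R).
Proof.
move=> bf fC; have C0 : 0 <= C by apply: le_trans (fC 1%g).
rewrite cesaroE walk_meanZ; last by apply: bm_sum => m; exact: bm_iter_averaging.
rewrite walk_mean_sum; last by move=> m; exact: bm_iter_averaging.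
rewrite -[X in _ - X](mulKf (x := M.+1%:R))// -mulrBr normrM ger0_norm ?invr_ge0//.
rewrite mulrC ler_pdivrMr//.
have -> : M.+1%:R * L N f = \sum_(m < M.+1) L N f.
  by rewrite sumr_const card_ord -(mulr_natr (L N f)) mulrC.
rewrite -sumrB (le_trans (ler_norm_sum _ _ _))//.
apply: (@le_trans _ _ (\sum_(m < M.+1) (M.+1%:R * (2 * C / N.+1%:R)))).
  apply: ler_sum => m _; apply: le_trans (walk_mean_iter _ _ bf fC) _.
  rewrite ler_wpM2r ?ler_nat ?(ltnW (ltn_ord m))//.
  by rewrite divr_ge0// mulr_ge0.
by rewrite sumr_const card_ord -(mulr_natr (_ * _)).
Qed.

Lemma averaging_cesaro C M f x : bm f -> bounded_by C f ->
  `|cesaro_mean M f x - avg1 (cesaro_mean M f) x| <= 2 * C / M.+1%:R.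
Proof.
move=> bf fC.
have -> : avg1 (cesaro_mean M f) x = M.+1%:R^-1 * \sum_(m < M.+1) iter m.+1 avg1 f x.
  rewrite cesaroE {1}/averaging.
  have bi m : bm (fun k => iter m avg1 f (k * x)%g).
    by apply: (bm_comp (rmul_measurable x)); exact: bm_iter_averaging.
  rewrite bm_integralZ; last exact: bm_sum.
  by congr (_ * _); rewrite bm_integral_sum.
rewrite cesaroE -mulrBr normrM ger0_norm ?invr_ge0// mulrC ler_wpM2r ?invr_ge0//.
rewrite -sumrB -(big_mkord xpredT (fun m => iter m avg1 f x - iter m.+1 avg1 f x)).
under eq_bigr do rewrite -opprB.
rewrite sumrN telescope_sumr// normrN (le_trans (ler_normB _ _))// mulrDl !mul1r.
by apply: lerD; [exact: (bounded_iter_averaging M.+1)|exact: fC].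
Qed.

Lemma bm_walk_mean N (h : borel G * borel G -> R) : bounded_measurable h ->
  bm (fun k => L N (fun x => h (k, x))).
Proof.
move=> bh; rewrite (_ : (fun k => _) = fun k => N.+1%:R^-1 *
    \sum_(n < N.+1) \int[walk n]_x h (k, x)); last first.
  by apply/funext => k; rewrite /walk_mean mulrC.
apply: bmZ; apply: bm_sum => n.
exact: (bm_partial_integral (walk n) bh).
Qed.

Lemma walk_mean_fubini N (h : borel G * borel G -> R) : bounded_measurable h ->
  \int[lam]_k L N (fun x => h (k, x)) = L N (fun x => \int[lam]_k h (k, x)).
Proof.
move=> bh.
transitivity (\int[lam]_k (N.+1%:R^-1 * \sum_(n < N.+1) \int[walk n]_x h (k, x))).
  by apply: eq_Rintegral => k _; rewrite /walk_mean mulrC.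
have bi n : bm (fun k => \int[walk n]_x h (k, x)).
  exact: (bm_partial_integral (walk n) bh).
rewrite bm_integralZ; last exact: bm_sum.
rewrite bm_integral_sum// /walk_mean mulrC; congr (_ / _).
by apply: eq_bigr => n _; exact: (bm_fubini lam (walk n) bh).
Qed.

(** Pull the square inside the mean, exchange the mean and the integral over [k],
    and expand the square: with [P] the averaging operator and [w] the Cesaro
    mean of [f], the bound is the mean of
    [(P (w ^ 2) - w ^ 2) + 2 * w * (w - P w)]. The first term is small since the
    mean is nearly invariant under [P], the second one since [w] is. *)
Lemma walk_mean_variance N M C f : bm f -> bounded_by C f ->
  \int[lam]_k (L N (fun x => cesaro_mean M f (k * x)%g) - L N (cesaro_mean M f)) ^+ 2 <=
  2 * C ^+ 2 / N.+1%:R + 4 * C ^+ 2 / M.+1%:R.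
Proof.
move=> bf fC; set w := cesaro_mean M f.
have C0 : 0 <= C by apply: le_trans (fC 1%g).
have bw : bm w by exact: bm_cesaro.
have wC : bounded_by C w by exact: bounded_cesaro.
have bwk k : bm (fun x => w (k * x)%g) by exact: bm_lmul.
have bw2 : bm (fun x => w x ^+ 2) by exact: bmM.
have wC2 : bounded_by (C ^+ 2) (fun x => w x ^+ 2).
  by move=> x; rewrite normrX lerXn2r ?nnegrE//.
pose h (p : borel G * borel G) := (w (p.1 * p.2)%g - w p.2) ^+ 2.
have bh0 : bounded_measurable (fun p : borel G * borel G => w (p.1 * p.2)%g - w p.2).
  apply: bmB; first exact: bm_mulg.
  exact: (bm_comp (u := fun p : borel G * borel G => p.2) measurable_snd bw).
have bh : bounded_measurable h by exact: bmM.
apply: (@le_trans _ _ (\int[lam]_k L N (fun x => h (k, x)))).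
  apply: le_bm_integral => [||k].
  - have b1 := bm_walk_mean N (bm_mulg scG bw).
    by apply: bmM; apply: bmB => //; exact: bm_cst.
  - exact: bm_walk_mean.
  by rewrite -walk_meanB//; apply: walk_mean_sqr; exact: bmB.
rewrite walk_mean_fubini//.
have -> : (fun x => \int[lam]_k h (k, x)) = fun x =>
    (avg1 (fun x => w x ^+ 2) x - w x ^+ 2) + 2 * (w x * (w x - avg1 w x)).
  apply/funext => x; rewrite /h/=.
  transitivity (\int[lam]_k (w (k * x)%g ^+ 2 - (2 * w x) * w (k * x)%g + w x ^+ 2)).
    by apply: eq_Rintegral => k _; ring.
  have bk := bm_comp (rmul_measurable x) bw.
  have bk2 := bm_comp (rmul_measurable x) bw2.
  have bk3 : bm (fun k => 2 * w x * w (k * x)%g) by exact: bmZ.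
  have bk4 : bm (fun k => w (k * x)%g ^+ 2 - 2 * w x * w (k * x)%g) by exact: bmB.
  rewrite (bm_integralD lam bk4 (bm_cst _ _)) integral_prob_cst.
  rewrite (bm_integralB lam bk2 bk3) bm_integralZ// /averaging.
  ring.
have ba2 : bm (avg1 (fun x => w x ^+ 2)) by exact: bm_averaging.
have ba : bm (fun x => w x * (w x - avg1 w x)).
  by apply: bmM => //; apply: bmB => //; exact: bm_averaging.
rewrite walk_meanD; [|exact: bmB|exact: bmZ].
rewrite walk_meanB// walk_meanZ//; apply: lerD.
  exact: le_trans (ler_norm _) (walk_mean_averaging N bw2 wC2).
have -> : 4 * C ^+ 2 / M.+1%:R = 2 * (C * (2 * C / M.+1%:R)) by ring.
rewrite ler_wpM2l// (le_trans (ler_norm _))//; apply: walk_mean_bounded => [|x].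
  exact: ba.1.
by rewrite normrM; apply: ler_pM => //; exact: averaging_cesaro.
Qed.

End conjugation_invariant_walk.

(** * Invariance of the walk means under the support *)

(** A bound on the total variation distance: the integrals only differ on the
    small set where the two probabilities do. *)
Lemma bm_integral_dist d (T : measurableType d) (R : realType)
    (P1 P2 : probability T R) (D : set T) (e C : R) (f : T -> R) :
  measurable D -> (forall A, measurable A -> A `<=` D -> P1 A = P2 A) ->
  (P1 (~` D) <= e%:E)%E -> (P2 (~` D) <= e%:E)%E ->
  bounded_measurable f -> bounded_by C f ->
  `|\int[P1]_x f x - \int[P2]_x f x| <= C * e *+ 2.
Proof.
move=> mD P12 P1D P2D bf fC.
have mDC : measurable (~` D) by exact: measurableC.
have C0 : 0 <= C by exact: le_trans (fC point).
have split (P : probability T R) : (P (~` D) <= e%:E)%E ->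
    exists2 r, \int[P]_x f x = \int[P]_(x in D) f x + r & `|r| <= C * e.
  move=> PD; exists (\int[P]_(x in ~` D) f x).
    rewrite -Rintegral_setU ?setUv//; first exact: bm_integrable.
    by apply/disj_setPS => x [].
  have iD : P.-integrable (~` D) (EFin \o f).
    exact: integrableS (bm_integrable P bf).
  apply: le_trans (le_normr_Rintegral mDC iD) _.
  apply: (@le_trans _ _ (\int[P]_(x in ~` D) C)).
    apply: le_Rintegral => //.
    - apply: (@integrableS _ _ _ _ setT) => //.
      exact: (bm_integrable P (bm_norm bf)).
    - apply: (@integrableS _ _ _ _ setT) => //.
      exact: (bm_integrable P (bm_cst _ C)).
  rewrite Rintegral_cst// ler_wpM2l// -lee_fin fineK//.
  exact: fin_num_measure.
have [r1 -> r1C] := split _ P1D; have [r2 -> r2C] := split _ P2D.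
have -> : \int[P1]_(x in D) f x = \int[P2]_(x in D) f x.
  by rewrite /Rintegral; congr fine; apply: eq_measure_integral => A mA AD; exact: P12.
rewrite opprD addrACA subrr add0r mulr2n (le_trans (ler_normB _ _))// lerD//.
Qed.

Section normalized_haar.
Variables (R : realType) (G : topologicalGroupType).
Hypothesis lcscG : lcsc G.
Variable mu : {measure set (borel G) -> \bar R}.
Hypothesis haar_mu : left_haar mu.

Lemma haar_compact_gt0 : exists2 Q : set G, compact Q & (0 < mu Q)%E.
Proof.
have [hG lG sG] := lcscG; have [B bB] := lcsc_compact_basis hG lG sG.
have [b1 b2 b3] := bB; case: haar_mu => /eqP muT _ _.
apply: contrapT => nQ; apply: muT.
have mB i : measurable (closure (B i) : set (borel G)).
  by apply: borel_closed; exact: closed_closure.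
have muB i : mu (closure (B i)) = 0%E.
  apply/eqP; rewrite eq_le measure_ge0 andbT leNgt; apply/negP => ?; apply: nQ.
  by exists (closure (B i)).
have -> : [set: G] = \bigcup_i closure (B i).
  apply/seteqP; split=> // x _; have [i Bix _] := b3 x setT filterT.
  by exists i => //; exact: subset_closure.
apply/eqP; rewrite eq_le measure_ge0 andbT.
apply: (@le_trans _ _ (\sum_(0 <= i <oo) mu (closure (B i)))%E).
  by apply: measure_sigma_subadditive => //; exact: bigcup_measurable.
by rewrite eseries0// => i _ _; exact: muB.
Qed.

(** Normalize the restriction of Haar measure to a compact set. The result moves
    continuously in total variation because Haar measure does; a point mass, the
    usual start of a walk, need not do so. *)
Lemma normalized_haar_exists : exists th : probability (borel G) R,
  (forall A, measurable A -> mu A = 0%E -> th A = 0%E) /\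
  (forall (k : G) (e : R), 0 < e -> \forall k' \near k,
     forall C (f : borel G -> R), bounded_measurable f -> bounded_by C f ->
     `|\int[th]_x f (k * x)%g - \int[th]_x f (k' * x)%g| <= C * e).
Proof.
have [hG lG sG] := lcscG.
have [Q cQ Q0] := haar_compact_gt0.
have mQ : measurable (Q : set (borel G)) by apply: borel_closed; exact: compact_closed.
have muQ := haar_compact_lty haar_mu cQ.
pose c := fine (mu Q).
have muQE : mu Q = c%:E by rewrite fineK// ge0_fin_numE.
have c0 : 0 < c by rewrite -lte_fin -muQE.
pose th : probability (borel G) R := mnormalize (mrestr mu mQ) (\d_ (1%g : borel G)).
have thE A : th A = (mu (A `&` Q) * c^-1%:E)%E.
  rewrite /th/= /mnormalize/=.
  have -> : mrestr mu mQ [set: borel G] = mu Q by rewrite /mrestr setTI.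
  by rewrite gt_eqF//= lt_eqF.
exists th; split=> [A mA A0|k e e0].
  rewrite thE; suff -> : mu (A `&` Q) = 0%E by rewrite mul0e.
  apply: subset_measure0 A0 => //; first exact: measurableI.
have mlm (g : G) := lmul_measurable g.
pose lmf g : {mfun borel G >-> borel G} :=
  HB.pack (fun x : borel G => (g * x)%g : borel G) (isMeasurableFun.Build _ _ _ _ _ (mlm g)).
pose pf (g : G) : probability (borel G) R := distribution th (lmf g).
have mKg (g : G) : measurable ([set (g * x)%g | x in Q] : set (borel G)).
  exact: lcoset_measurable.
have pfE g A : measurable A -> pf g A = (mu (A `&` [set (g * x)%g | x in Q]) * c^-1%:E)%E.
  move=> mA; rewrite /pf /distribution /pushforward /= thE; congr (_ * _)%E.
  rewrite -(haar_lcoset haar_mu g); last first.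
    apply: measurableI => //; rewrite -[X in measurable X]setTI.
    exact: (lmul_measurable g).
  congr (mu _); apply/seteqP; split=> [_ [x [/= Ax Qx] <-]|t [At [x Qx xt]]].
    by split=> //; exists x.
  by exists x => //; split=> //=; rewrite xt.
have pfint (g : G) (f : borel G -> R) : bounded_measurable f -> \int[th]_x f (g * x)%g = \int[pf g]_x f x.
  move=> bf; rewrite /Rintegral; congr fine.
  have := @integral_pushforward _ _ _ _ R _ (lmul_measurable g) th setT (EFin \o f).
  rewrite preimage_setT => H; rewrite -[LHS]H//.
  - by apply/measurable_EFinP; exact: bf.1.
  - by apply: bm_integrable; exact: (bm_comp (lmul_measurable g)).
have ec0 : 0 < e * c / 2 by rewrite divr_gt0 ?mulr_gt0.
apply: filterS (haar_translation_continuous lcscG haar_mu k cQ ec0) => k' [kk' k'k].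
move=> C f bf fC; rewrite !pfint//.
pose D : set (borel G) := [set (k * x)%g | x in Q] `&` [set (k' * x)%g | x in Q].
have mD : measurable D by exact: measurableI.
have small g g' : (mu ([set (g * x)%g | x in Q] `\` [set (g' * x)%g | x in Q]) <
    (e * c / 2)%:E)%E -> (pf g (~` ([set (g * x)%g | x in Q] `&` [set (g' * x)%g | x in Q]))
       <= (e / 2)%:E)%E.
  move=> gg'; rewrite pfE; last by apply: measurableC; exact: measurableI.
  have -> : ~` ([set (g * x)%g | x in Q] `&` [set (g' * x)%g | x in Q]) `&`
     [set (g * x)%g | x in Q] = [set (g * x)%g | x in Q] `\` [set (g' * x)%g | x in Q].
    by apply/seteqP; split=> [x [nI gx]|x [gx ngx]]; split=> //; [move=> g'x; exact: nI|case].
  rewrite muleC -lee_pdivlMl ?invr_gt0// invrK -EFinM; apply/ltW.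
  by rewrite (_ : c * (e / 2) = e * c / 2)//; ring.
have -> : C * e = C * (e / 2) *+ 2 by rewrite -mulrnAr -mulr_natr divfK.
apply: (bm_integral_dist mD) => //.
- move=> A mA AD; rewrite !pfE// !setIidl//.
    by move=> x /AD[].
  by move=> x /AD[].
- exact: small.
- by rewrite /D setIC; exact: small.
Qed.
End normalized_haar.

Lemma lcsc_second_countable (G : topologicalGroupType) :
  lcsc G -> @second_countable G.
Proof. by case. Qed.

Definition measure_support (R : realType) (T : ptopologicalType)
    (P : probability (borel T) R) : set T :=
  [set x | forall V : set T, open V -> V x -> (0 < P V)%E].

Section invariant_mean.
Variables (R : realType) (G : topologicalGroupType).
Hypothesis lcscG : lcsc G.
Let scG : @second_countable G := lcsc_second_countable lcscG.
Variable lam : probability (borel G) R.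
Hypothesis lam_conj : forall (g : G) (A : set (borel G)), measurable A ->
  lam ((fun x : borel G => (x ^ g)%g : borel G) @^-1` A) = lam A.
Variable th0 : probability (borel G) R.
Hypothesis th0_continuous : forall (k : G) (e : R), 0 < e -> \forall k' \near k,
  forall C (f : borel G -> R), bounded_measurable f -> bounded_by C f ->
  `|\int[th0]_x f (k * x)%g - \int[th0]_x f (k' * x)%g| <= C * e.

Local Notation bm := (@bounded_measurable _ (borel G) R).
Local Notation L := (walk_mean scG lam th0).
Implicit Types (f w : borel G -> R) (C : R).

(** Translations commute with all powers of the averaging operator, so that the
    continuity of the translates of [th0] passes to every step of the walk, with
    the same neighborhood. *)
Lemma walk_mean_equicontinuous (k : G) (e : R) : 0 < e -> \forall k' \near k,
  forall N C f, bm f -> bounded_by C f ->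
  `|L N (fun x => f (k * x)%g) - L N (fun x => f (k' * x)%g)| <= C * e.
Proof.
move=> e0; apply: filterS (th0_continuous k e0) => k' H N C f bf fC.
rewrite /walk_mean -mulrBl normrM [X in _ * X]ger0_norm ?invr_ge0//.
rewrite ler_pdivrMr// -sumrB (le_trans (ler_norm_sum _ _ _))//.
apply: (@le_trans _ _ (\sum_(n < N.+1) (C * e))).
  apply: ler_sum => n _; rewrite !(integral_walk scG lam th0) //; try exact: bm_lmul.
  rewrite !(iter_averaging_lmul scG lam_conj)//.
  apply: H; first exact: bm_iter_averaging.
  exact: bounded_iter_averaging.
by rewrite sumr_const card_ord -(mulr_natr (_ * _)).
Qed.

(** A function and its Cesaro mean have nearly the same walk mean, and so do their
    translates, to which [cesaro_lmul] applies. *)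
Lemma walk_mean_variance_cvg0 C f (eta : R) : bm f -> bounded_by C f -> 0 < eta ->
  \forall N \near \oo,
    \int[lam]_k (L N (fun x => f (k * x)%g) - L N f) ^+ 2 < eta.
Proof.
move=> bf fC eta0; have C0 : 0 <= C by apply: le_trans (fC 1%g).
(* [M] is chosen first; [K / N.+1] then bounds all the errors in which [N] occurs. *)
have [M [_ Meta]] : exists M, True /\ 8 * C ^+ 2 / M.+1%:R < eta / 2.
  have e1 : 0 < eta / 2 / (8 * C ^+ 2 + 1) by rewrite divr_gt0 ?divr_gt0// ltr_wpDl ?mulr_ge0 ?sqr_ge0.
  have [M _ /(_ M (leqnn M)) HM] := near_infty_natSinv_lt (PosNum e1).
  exists M; split=> //; move: HM => /=; rewrite ltr_pdivlMr ?ltr_wpDl ?mulr_ge0 ?sqr_ge0//.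
  apply: le_lt_trans; rewrite mulrC ler_wpM2l ?invr_ge0//.
  by rewrite lerDl.
pose K := 4 * C ^+ 2 + 2 * (4 * M.+1%:R * C) ^+ 2.
have K0 : 0 <= K by rewrite addr_ge0 ?mulr_ge0 ?sqr_ge0.
have e2 : 0 < eta / 2 / (K + 1) by rewrite divr_gt0 ?divr_gt0// ltr_wpDl.
apply: filterS (near_infty_natSinv_lt (PosNum e2)) => N /=.
rewrite ltr_pdivlMr ?ltr_wpDl// => HN.
set w := cesaro_mean lam M f.
have bw : bm w by exact: bm_cesaro.
pose G0 k := L N (fun x => w (k * x)%g) - L N w.
pose d := 2 * (M.+1%:R * (2 * C / N.+1%:R)).
have bG h : bm h -> bm (fun k => L N (fun x => h (k * x)%g) - L N h).
  move=> bh; apply: bmB; last exact: bm_cst.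
  exact: (bm_walk_mean scG lam th0 N (bm_mulg scG bh)).
have bG2 h : bm h -> bm (fun k => (L N (fun x => h (k * x)%g) - L N h) ^+ 2).
  by move=> bh; apply: bmM; exact: bG.
apply: (@le_lt_trans _ _ (\int[lam]_k (2 * G0 k ^+ 2 + 2 * d ^+ 2))).
  apply: le_bm_integral => [||k].
  - exact: bG2.
  - by apply: bmD; [apply: bmZ; exact: bG2|exact: bm_cst].
  rewrite -/w; set a := L N (fun x => f (k * x)%g) - L N f.
  have ad : `|a - G0 k| <= d.
    have -> : a - G0 k = (L N w - L N f) -
      (L N (cesaro_mean lam M (fun x => f (k * x)%g)) - L N (fun x => f (k * x)%g)).
      by rewrite (cesaro_lmul scG lam_conj)// /a /G0 -/w; ring.
    rewrite (le_trans (ler_normB _ _))// /d mulrDl !mul1r lerD//.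
      exact: walk_mean_cesaro.
    by apply: walk_mean_cesaro; [exact: bm_lmul|move=> x; exact: fC].
  have d2 : (a - G0 k) ^+ 2 <= d ^+ 2.
    have d0 : 0 <= d by exact: le_trans ad.
    by rewrite -[leLHS]real_normK ?num_real// lerXn2r ?nnegrE.
  apply: (@le_trans _ _ (2 * G0 k ^+ 2 + 2 * (a - G0 k) ^+ 2)).
    rewrite -subr_ge0.
    have -> : 2 * G0 k ^+ 2 + 2 * (a - G0 k) ^+ 2 - a ^+ 2 = (a - 2 * G0 k) ^+ 2 by ring.
    exact: sqr_ge0.
  by rewrite lerD2l ler_wpM2l.
have bc : bm (fun=> 2 * d ^+ 2) by exact: bm_cst.
have bGG : bm (fun k => 2 * G0 k ^+ 2) by apply: bmZ; exact: bG2.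
rewrite (bm_integralD lam bGG bc) integral_prob_cst bm_integralZ; last exact: bG2.
have HV := walk_mean_variance scG lam th0 N M bf fC.
apply: (@le_lt_trans _ _ (2 * (2 * C ^+ 2 / N.+1%:R + 4 * C ^+ 2 / M.+1%:R) + 2 * d ^+ 2)).
  by rewrite lerD2r ler_wpM2l.
rewrite [ltRHS](splitr eta).
apply: (@le_lt_trans _ _ (K / N.+1%:R + 8 * C ^+ 2 / M.+1%:R)).
  have -> : 2 * (2 * C ^+ 2 / N.+1%:R + 4 * C ^+ 2 / M.+1%:R) + 2 * d ^+ 2 =
    4 * C ^+ 2 / N.+1%:R + 2 * (4 * M.+1%:R * C) ^+ 2 * (N.+1%:R^-1 ^+ 2) + 8 * C ^+ 2 / M.+1%:R.
    by rewrite /d; ring.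
  rewrite lerD2r /K [leRHS]mulrDl lerD2l ler_wpM2l ?mulr_ge0 ?sqr_ge0//.
  by rewrite expr2 ler_piMr ?invr_ge0// invf_le1// ler1n.
apply: ltrD => //; apply: le_lt_trans HN.
by rewrite mulrC ler_wpM2l ?invr_ge0// lerDl.
Qed.

(** If the difference were at least [e] at a point [k] of the support, it would be
    at least [e / 2] on a neighborhood of [k] that does not depend on [N], and
    the variance could not tend to [0]. *)
Lemma walk_mean_invariant C f (k : G) (e : R) : measure_support lam k ->
  bm f -> bounded_by C f -> 0 < e ->
  \forall N \near \oo, `|L N (fun x => f (k * x)%g) - L N f| < e.
Proof.
move=> suppk bf fC e0; have C0 : 0 <= C by apply: le_trans (fC 1%g).
have e1 : 0 < e / 2 / (C + 1) by rewrite divr_gt0 ?divr_gt0// ltr_wpDl.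
have nS := walk_mean_equicontinuous k e1.
have [V [oV Vk VH]] : exists V : set G, [/\ open V, V k & forall k', V k' ->
    forall N C' w, bm w -> bounded_by C' w ->
    `|L N (fun x => w (k * x)%g) - L N (fun x => w (k' * x)%g)| <=
      C' * (e / 2 / (C + 1))].
  exists (interior [set k' | forall N C' w, bm w -> bounded_by C' w ->
    `|L N (fun x => w (k * x)%g) - L N (fun x => w (k' * x)%g)| <=
      C' * (e / 2 / (C + 1))]).
  split; [exact: open_interior|exact: nS|].
  by move=> k' /interior_subset.
have lV := suppk V oV Vk.
have mV : measurable (V : set (borel G)) by exact: borel_open.
pose v := fine (lam V).
have v0 : 0 < v by rewrite /v fine_gt0// lV/= (le_lt_trans (probability_le1 _ _))// ltry.
have eta0 : 0 < (e / 2) ^+ 2 * v by rewrite mulr_gt0// exprn_gt0// divr_gt0.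
apply: filterS (walk_mean_variance_cvg0 bf fC eta0) => N HN.
rewrite ltNge; apply/negP => eN; move: HN; apply/negP; rewrite -leNgt.
pose F k' := L N (fun x => f (k' * x)%g) - L N f.
have bF : bm F.
  apply: bmB; last exact: bm_cst.
  exact: (bm_walk_mean scG lam th0 N (bm_mulg scG bf)).
have VF k' : V k' -> (e / 2) ^+ 2 <= F k' ^+ 2.
  move=> Vk'; have := VH k' Vk' N C f bf fC => H1.
  have H2 : `|L N (fun x => f (k * x)%g) - L N (fun x => f (k' * x)%g)| <= e / 2.
    apply: le_trans H1 _; rewrite mulrCA ler_piMr ?divr_ge0 ?ltW//.
    by rewrite ltr_pdivrMr ?mul1r ?ltrDl// ltr_wpDl.
  have H3 : e / 2 <= `|F k'|.
    have := ler_normD (L N (fun x => f (k * x)%g) - L N (fun x => f (k' * x)%g)) (F k').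
    rewrite /F subrKA => /(le_trans eN) => H4; lra.
  have e20 : 0 <= e / 2 by rewrite divr_ge0// ltW.
  by rewrite -[leRHS]real_normK ?num_real// lerXn2r ?nnegrE.
apply: (@le_trans _ _ (\int[lam]_k' ((e / 2) ^+ 2 * \1_V k'))).
  rewrite bm_integralZ.
    by rewrite /Rintegral integral_indic// setIT.
  split; first exact: measurable_indic.
  by exists 1 => x; rewrite indicE; case: (_ \in _); rewrite ?normr1 ?normr0.
apply: le_bm_integral => [||k'].
- apply: bmZ; split; first exact: measurable_indic.
  by exists 1 => x; rewrite indicE; case: (_ \in _); rewrite ?normr1 ?normr0.
- exact: bmM.
rewrite indicE; case: (boolP (k' \in V)) => [/set_mem/VF|_]; rewrite ?mulr1 ?mulr0//.
exact: sqr_ge0.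
Qed.

End invariant_mean.

(** * Amenability from a conjugation-invariant probability *)

Lemma normal_csubP (G : topologicalGroupType) (N : closedSubgroup G) :
  (forall x g, (N : set G) x -> (N : set G) (x ^ g)%g) -> normal_csub N.
Proof.
move=> NJ g; apply: closedSubgroup_eq; apply/seteqP; split=> x; last exact: NJ.
by move=> /(NJ _ g^-1%g); rewrite conjgK.
Qed.

Section closed_normal_generated.
Variables (G : topologicalGroupType) (S : set G).
Hypothesis S_conj : forall x g, S x -> S (x ^ g)%g.

Let inter : set G := [set x | forall H : closedSubgroup G, S `<=` H -> (H : set G) x].

Let inter_closed : closed inter.
Proof.
move=> x clx H SH; apply: csub_closed => V xV.
by have [y [/(_ _ SH) Hy Vy]] := clx V xV; exists y.
Qed.

Let inter1 : inter 1%g. Proof. by move=> H _; exact: csub1. Qed.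

Let interM x y : inter x -> inter y -> inter (x * y)%g.
Proof. by move=> Hx Hy H SH; apply: csubM; [exact: Hx|exact: Hy]. Qed.

Let interV x : inter x -> inter x^-1%g.
Proof. by move=> Hx H SH; apply: csubV; exact: Hx. Qed.

Definition csub_generated : closedSubgroup G :=
  ClosedSubgroup inter_closed inter1 interM interV.

Lemma sub_csub_generated : S `<=` csub_generated.
Proof. by move=> x Sx H; exact. Qed.

Lemma csub_generated_sub (H : closedSubgroup G) : S `<=` H -> csub_generated `<=` H.
Proof. by move=> SH x; exact. Qed.

Lemma csub_generated_normal : normal_csub csub_generated.
Proof.
apply: normal_csubP => x g Nx.
have sub : S `<=` conj_csub g csub_generated.
  by move=> y Sy; apply: sub_csub_generated; exact: S_conj.
exact: (csub_generated_sub sub Nx).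
Qed.

End closed_normal_generated.

Lemma measure_support_full (R : realType) (T : ptopologicalType)
    (P : probability (borel T) R) : @second_countable T ->
  P (~` measure_support P) = 0%E /\ measurable (measure_support P : set (borel T)).
Proof.
move=> /second_countable_open_basis[B [oB bB]].
have suppE : ~` measure_support P =
    \bigcup_i (if `[< P (B i) = 0%E >] then B i else set0).
  apply/seteqP; split=> [x /existsNP[V]|x [i _]].
    move=> /not_implyP[oV] /not_implyP[Vx /negP]; rewrite -leNgt => PV0.
    have [i Bix BiV] := bB x V (open_nbhs_nbhs (conj oV Vx)).
    exists i => //; case: asboolP => // -[]; apply/eqP.
    rewrite eq_le measure_ge0 andbT; apply: le_trans PV0.
    by apply: le_measure; rewrite ?inE//; exact: borel_open.
  case: asboolP => // PBi Bix /(_ (B i) (oB i) Bix).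
  by rewrite PBi ltxx.
have mB i : measurable ((if `[< P (B i) = 0%E >] then B i else set0) : set (borel T)).
  by case: ifP => _; [exact: borel_open|exact: measurable0].
split.
  rewrite suppE; apply/eqP; rewrite eq_le measure_ge0 andbT.
  apply: (@le_trans _ _ (\sum_(0 <= i <oo) P (if `[< P (B i) = 0%E >] then B i else set0))%E).
    by apply: measure_sigma_subadditive => //; exact: bigcup_measurable.
  rewrite eseries0// => i _ _ /=; case: asboolP => [->//|_]; exact: measure0.
rewrite -[X in measurable X]setCK; apply: measurableC; rewrite suppE.
exact: bigcup_measurable.
Qed.

Section amenability.
Variables (R : realType) (G : topologicalGroupType).
Hypothesis lcscG : lcsc G.
Let scG : @second_countable G := lcsc_second_countable lcscG.
Variable mu : {measure set (borel G) -> \bar R}.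
Hypothesis haar_mu : left_haar mu.
Variable lam : probability (borel G) R.
Hypothesis lam_conj : forall (g : G) (A : set (borel G)), measurable A ->
  lam ((fun x : borel G => (x ^ g)%g : borel G) @^-1` A) = lam A.
Variable th0 : probability (borel G) R.
Hypothesis th0_ac : forall A, measurable A -> mu A = 0%E -> th0 A = 0%E.
Hypothesis th0_continuous : forall (k : G) (e : R), 0 < e -> \forall k' \near k,
  forall C (f : borel G -> R), bounded_measurable f -> bounded_by C f ->
  `|\int[th0]_x f (k * x)%g - \int[th0]_x f (k' * x)%g| <= C * e.

Local Notation bm := (@bounded_measurable _ (borel G) R).
Local Notation L := (walk_mean scG lam th0).
Local Notation walk := (walk scG lam th0).
Implicit Types (f w : borel G -> R) (C : R).

Lemma measure_support_conj (x g : G) :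
  measure_support lam x -> measure_support lam (x ^ g)%g.
Proof.
move=> sx V oV Vxg; rewrite -(lam_conj g); last exact: borel_open.
apply: sx => //; apply: open_comp => // y _.
exact: conjg_continuous.
Qed.

(** Haar-null sets have null translates, so they stay null along the walk; hence
    the means below only depend on classes of functions. *)
Lemma walk_ac n A : measurable A -> mu A = 0%E -> walk n A = 0%E.
Proof.
elim: n A => [|n ih] A mA muA; first exact: th0_ac.
rewrite /= /convolution /distribution /pushforward /product_measure1/=.
rewrite (eq_integral (fun=> 0%E)) ?integral0// => k _ /=.
have -> : xsection ((fun p : borel G * borel G => (p.1 * p.2)%g) @^-1` A) k =
    [set (k^-1 * x)%g | x in A].
  by apply/seteqP; split=> x; rewrite lcosetE invgK /xsection/= inE.
apply: ih; first exact: lcoset_measurable.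
by rewrite haar_lcoset.
Qed.

Lemma walk_mean_ae N f w : measurable_fun setT f -> measurable_fun setT w ->
  f = w %[ae mu] -> L N f = L N w.
Proof.
move=> mf mw [A [mA A0 fwA]]; rewrite /walk_mean; congr (_ / _).
apply: eq_bigr => n _; rewrite /Rintegral; congr fine.
apply: ae_eq_integral => //; [exact/measurable_EFinP|exact/measurable_EFinP|].
exists A; split=> //; first exact: walk_ac.
by move=> x /= nfw; apply: fwA => /= fw; apply: nfw => /fw/= ->.
Qed.

(** An essentially bounded function is truncated on a null set, since the walk
    means are controlled on bounded functions. *)
Lemma Lfun_bounded_measurable f : f \in Lfun mu +oo%E ->
  measurable_fun setT f /\ exists2 w, bm w & f = w %[ae mu].
Proof.
move=> fL; have mf : measurable_fun setT f := set_mem (sub_Lfun_mfun fL).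
have ff : finite_norm mu +oo%E f := set_mem (sub_Lfun_finLfun fL).
split=> //.
have mT : (0 < mu setT)%E.
  by case: haar_mu => muT _ _; rewrite lt_neqAle eq_sym muT measure_ge0.
move: ff; rewrite /finite_norm unlock mT => /ess_supr_bounded[C fC].
exists (fun x => if `|f x| <= C then f x else 0).
  split.
    apply: measurable_fun_ifT => //.
    by apply: measurable_fun_ler => //; exact: measurableT_comp.
  exists `|C| => x; case: ifPn => [H|_]; last by rewrite normr0.
  exact: le_trans H (ler_norm _).
apply: filterS fC => x /= H _.
by rewrite H.
Qed.

Variable U : set_system nat.
Hypotheses (UU : UltraFilter U) (oU : \oo `<=` U).

Let UP : ProperFilter U. Proof. exact: ultra_proper. Qed.

Definition limit_mean f : R := lim (L N f @[N --> U]).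

Local Notation M := limit_mean.

Lemma cvg_limit_mean f : bm f -> L N f @[N --> U] --> M f.
Proof.
move=> [mf [C fC]].
exact: (@ultra_bounded_cvg _ _ _ UU _ C (fun N => walk_mean_bounded scG lam th0 N mf fC)).
Qed.

Lemma limit_mean_ae f w : measurable_fun setT f -> measurable_fun setT w ->
  f = w %[ae mu] -> M f = M w.
Proof.
move=> mf mw fw; rewrite /limit_mean.
have -> // : (fun N => L N f) = (fun N => L N w).
by apply/funext => N; exact: walk_mean_ae.
Qed.

Lemma limit_mean_unique f l : L N f @[N --> U] --> l -> M f = l.
Proof. exact: (cvg_lim (@Rhausdorff R)). Qed.

Lemma limit_mean_linear c f w : bm f -> bm w ->
  M (fun x => c * f x + w x) = c * M f + M w.
Proof.
move=> bf bw; apply: limit_mean_unique.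
have -> : (fun N => L N (fun x => c * f x + w x)) = (fun N => c * L N f + L N w).
  by apply/funext => N; rewrite walk_meanD ?walk_meanZ//; exact: bmZ.
apply: cvgD; last exact: (cvg_limit_mean bw).
exact: (cvgM (@cvg_cst R c _ U _) (cvg_limit_mean bf)).
Qed.

(* Closedness comes from the equicontinuity of the walk means. *)
Let stab : set G := [set g | forall f, bm f -> M (fun x => f (g * x)%g) = M f].

Let stab_closed : closed stab.
Proof.
move=> g clg f bf; have [mf [C fC]] := bf.
have C0 : 0 <= C by apply: le_trans (fC 1%g).
apply/eqP; rewrite -subr_eq0 -normr_le0; apply/ler_addgt0Pr => e e0; rewrite add0r.
have e1 : 0 < e / (C + 1) by rewrite divr_gt0// ltr_wpDl.
have nS := walk_mean_equicontinuous lcscG lam_conj th0_continuous g e1.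
have [k [kstab kg]] := clg _ nS.
rewrite -(kstab f bf).
have cv := cvg_norm (cvgB (cvg_limit_mean (bm_lmul g bf)) (cvg_limit_mean (bm_lmul k bf))).
apply: (le_cvg_along UP (cv _ _) (@cvg_cst R e _ U _)).
apply: nearW => N; apply: le_trans (kg N C f bf fC) _.
rewrite mulrCA ler_piMr ?ltW//.
by rewrite ltr_pdivrMr ?mul1r ?ltrDl// ltr_wpDl.
Qed.

Let stab1 : stab 1%g.
Proof. by move=> f bf; congr M; apply/funext => x; rewrite mul1g. Qed.

Let stabM x y : stab x -> stab y -> stab (x * y)%g.
Proof.
move=> sx sy f bf; rewrite -(sx f bf) -(sy _ (bm_lmul x bf)).
by congr M; apply/funext => z; rewrite mulgA.
Qed.

Let stabV x : stab x -> stab x^-1%g.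
Proof.
move=> sx f bf; rewrite -(sx _ (bm_lmul x^-1%g bf)).
by congr M; apply/funext => z; rewrite mulKg.
Qed.

Definition limit_mean_stabilizer : closedSubgroup G :=
  ClosedSubgroup stab_closed stab1 stabM stabV.

Lemma limit_mean_stabilizer_support : measure_support lam `<=` limit_mean_stabilizer.
Proof.
move=> k sk f bf; have [mf [C fC]] := bf.
apply/eqP; rewrite -subr_eq0 -normr_le0; apply/ler_addgt0Pr => e e0; rewrite add0r.
have cv := cvg_norm (cvgB (cvg_limit_mean (bm_lmul k bf)) (cvg_limit_mean bf)).
apply: (le_cvg_along UP (cv _ _) (@cvg_cst R e _ U _)).
apply: oU; apply: filterS (walk_mean_invariant lcscG lam_conj th0_continuous sk bf fC e0).
by move=> N /ltW.
Qed.

End amenability.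

(** The mean [limit_mean] is preserved by a closed subgroup that contains the
    support of [lam]. The support is invariant under conjugation and not reduced
    to [1], so the closed subgroup that it generates is normal and nontrivial,
    hence is [G]. *)
Theorem amenable_of_conj_invariant (R : realType) (G : topologicalGroupType)
    (lam : probability (borel G) R) : lcsc G -> simple_tgroup G ->
  (forall (g : G) (A : set (borel G)), measurable A ->
     lam ((fun x : borel G => (x ^ g)%g : borel G) @^-1` A) = lam A) ->
  lam [set 1%g] = 0%E -> amenable R G.
Proof.
move=> lcscG simG lam_conj lam1.
have [hG lG scG] := lcscG.
have [mu haar_mu] := haar_exists R lcscG.
exists mu => //.
have [th0 [th0_ac th0_cont]] := normalized_haar_exists lcscG haar_mu.
have [U [UU oU]] := ultraFilterLemma (@eventually_filter).
pose M := limit_mean lcscG lam th0 U.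
have genT : csub_generated (measure_support lam) = setT :> set G.
  have nor := csub_generated_normal (measure_support_conj lam_conj).
  have [gen1|//] := simG _ nor.
  have [s0 ms] := measure_support_full lam scG.
  have : lam (measure_support lam) = 0%E.
    apply: subset_measure0 lam1 => //.
      by apply: borel_closed; apply: compact_closed => //; exact: compact_set1.
    by rewrite -gen1; exact: sub_csub_generated.
  move=> sE; have := probability_setC lam ms.
  by rewrite s0 sE sube0 => /esym/eqP; rewrite onee_eq0.
have inv (g : G) (f : borel G -> R) : bounded_measurable f -> M (fun x => f (g * x)%g) = M f.
  have : (limit_mean_stabilizer lcscG lam_conj th0_cont UU : set G) g.
    have sub := limit_mean_stabilizer_support lcscG lam_conj th0_cont UU oU.
    by apply: (csub_generated_sub sub); rewrite genT.
  exact.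
have Mae f w : measurable_fun setT f -> measurable_fun setT w ->
    f = w %[ae mu] -> M f = M w.
  exact: (limit_mean_ae lcscG haar_mu lam th0_ac).
exists M; split.
- move=> f h /(Lfun_bounded_measurable haar_mu)[mf _].
  move=> /(Lfun_bounded_measurable haar_mu)[mh _].
  exact: Mae.
- move=> c f h /(Lfun_bounded_measurable haar_mu)[mf [f' bf' ff']].
  move=> /(Lfun_bounded_measurable haar_mu)[mh [h' bh' hh']].
  rewrite (Mae _ _ mf bf'.1 ff').
  rewrite (Mae _ _ mh bh'.1 hh').
  rewrite -(limit_mean_linear lcscG lam th0 UU c bf' bh'); apply: Mae.
  + by apply: measurable_funD => //; exact: measurable_funM.
  + by apply: measurable_funD; [apply: measurable_funM => //; exact: bf'.1|exact: bh'.1].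
  by move: ff' hh'; apply: filterS2 => x /= H1 H2 _; rewrite H1// H2.
- move=> f /(Lfun_bounded_measurable haar_mu)[mf [f' bf' ff']] f0.
  rewrite (Mae _ _ mf bf'.1 ff').
  have cv := @cvg_limit_mean R G lcscG lam th0 U UU f' bf'.
  apply: (le_cvg_along ultra_proper (@cvg_cst R 0 _ U _) cv).
  apply: nearW => N; rewrite -(walk_mean_ae lcscG haar_mu lam th0_ac N mf bf'.1 ff').
  by rewrite divr_ge0// sumr_ge0// => n _; apply: Rintegral_ge0.
- apply: (limit_mean_unique UU).
  have -> : (fun N => walk_mean (lcsc_second_countable lcscG) lam th0 N (fun=> 1)) = fun=> 1.
    by apply/funext => N; rewrite walk_mean_cst.
  exact: cvg_cst.
- move=> g f /(Lfun_bounded_measurable haar_mu)[mf [f' bf' ff']].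
  have bfg' : bounded_measurable (fun x : borel G => f' (g^-1 * x)%g) by exact: bm_lmul.
  have mfg : measurable_fun setT (fun x : borel G => f (g^-1 * x)%g).
    exact: (measurableT_comp mf (lmul_measurable g^-1%g)).
  rewrite (Mae _ _ mf bf'.1 ff') -(inv g^-1%g f' bf').
  apply: (Mae _ _ mfg bfg'.1).
  case: ff' => A [mA A0 ffA]; exists [set (g * x)%g | x in A]; split.
  + exact: lcoset_measurable.
  + by rewrite (haar_lcoset haar_mu).
  move=> x /= nfx; exists (g^-1 * x)%g; last by rewrite mulVKg.
  by apply: ffA => /= H; apply: nfx => _; exact: H.
Qed.

(** * Coordinates that are continuous along orbits *)

Section compact_pi_system.
Variables (T : ptopologicalType) (B : nat -> set T).
Hypotheses (hT : hausdorff_space T) (bB : compact_basis B).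

(** A nonempty finite intersection of basic closed sets, the index of the first one
    being kept apart to ensure compactness. These sets form a countable pi-system
    that generates the Borel sets. *)
Definition basic_compact (p : nat * seq nat) : set T :=
  [set x | forall j, j \in p.1 :: p.2 -> closure (B j) x].

Lemma basic_compact_closed p : closed (basic_compact p).
Proof.
have -> : basic_compact p = \bigcap_(j in [set j | j \in p.1 :: p.2]) closure (B j) by [].
by apply: closed_bigI => j _; exact: closed_closure.
Qed.

Lemma basic_compact_compact p : compact (basic_compact p).
Proof.
case: bB => _ b2 _; apply: (subclosed_compact _ (b2 p.1)).
  exact: basic_compact_closed.
by move=> x; apply; rewrite inE eqxx.
Qed.

Lemma basic_compactI : setI_closed (range basic_compact).
Proof.
move=> _ _ [p _ <-] [q _ <-]; exists (p.1, p.2 ++ q.1 :: q.2) => //.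
apply/seteqP; split=> [x H|x [Hp Hq] j].
  split=> j jp; apply: H; rewrite -cat_cons mem_cat.
    by rewrite jp.
  by rewrite jp orbT.
by rewrite -cat_cons mem_cat => /orP[]; [exact: Hp|exact: Hq].
Qed.

Lemma borel_basic_compact (A : set (borel T)) : measurable A ->
  <<s range basic_compact >> A.
Proof.
apply: smallest_sub; first exact: smallest_sigma_algebra.
move=> U oU; rewrite (compact_basis_bigcup bB oU) bigcup_mkcond.
pose S : measurableType _ := g_sigma_algebraType (range basic_compact).
apply: (@bigcup_measurable _ S) => i _.
case: ifP => _; last exact: (@measurable0 _ S).
apply: sub_sigma_algebra; exists (i, [::]) => //.
apply/seteqP; split=> [x|x cx j]; last by rewrite inE => /eqP ->.
by apply; rewrite inE eqxx.
Qed.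

End compact_pi_system.

Section topological_model.
Variables (R : realType) (G : topologicalGroupType).
Hypothesis lcscG : lcsc G.
Variables (d : measure_display) (X : measurableType d) (b : G -> X -> X).
Hypothesis b_action : is_group_action b.
Variable S : nat -> set X.
Hypothesis S_measurable :
  forall n, measurable [set p : borel G * X | S n (b p.1 p.2)].
Hypothesis S_separating : forall x y, (forall n, S n x <-> S n y) -> x = y.

Variable mu : {measure set (borel G) -> \bar R}.
Hypothesis haar_mu : left_haar mu.

Let hG : hausdorff_space G. Proof. by case: lcscG. Qed.

(** The inverse turns left translation of the group variable into the action on
    [X], see [occupation_translate]. *)
Definition return_set n : set (borel G * X) := [set p | S n (b p.1^-1%g p.2)].

Lemma return_set_measurable n : measurable (return_set n).
Proof.
have minv : measurable_fun setT (fun x : borel G => x^-1%g : borel G).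
  exact: continuous_borel (@invg_continuous G).
have m : measurable_fun setT (fun p : borel G * X => (p.1^-1%g : borel G, p.2)).
  apply/measurable_fun_pairP; split; last exact: measurable_snd.
  exact: (measurableT_comp minv (@measurable_fst _ _ (borel G) X)).
rewrite -[X in measurable X]setTI.
exact: (m measurableT _ (S_measurable n)).
Qed.

Definition occupation (K : set G) n (x : X) : R :=
  fine (mu (K `&` ysection (return_set n) x)).

Lemma occupation_measurable (K : set G) n : compact K ->
  measurable_fun setT (occupation K n).
Proof.
move=> cK; have mK : measurable (K : set (borel G)).
  by apply: borel_closed; exact: compact_closed.
have muK := haar_compact_lty haar_mu cK.
have := measurable_fun_ysection (mfrestr mK muK) (return_set_measurable n).
move=> m; apply: (measurableT_comp (f := fine)) => //.
by apply: eq_measurable_fun m => x _ /=; rewrite /mfrestr /mrestr setIC.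
Qed.

(** Moving the point amounts to translating [K]; this is the source of continuity
    along orbits. *)
Lemma occupation_translate (K : set G) n (g : G) (x : X) : compact K ->
  occupation K n (b g x) =
  fine (mu ([set (g^-1 * k)%g | k in K] `&` ysection (return_set n) x)).
Proof.
move=> cK; rewrite /occupation; congr fine.
have mK : measurable (K : set (borel G)).
  by apply: borel_closed; exact: compact_closed.
rewrite -(haar_lcoset haar_mu g^-1%g); last first.
  apply: measurableI => //; exact: (measurable_ysection _ (return_set_measurable n)).
have [_ bM] := b_action.
congr (mu _); apply/seteqP; split=> [_ [h [Kh]] + <-|_ [[k Kk <-]]].
  rewrite /ysection/= !inE /return_set/= => Sh; split; first by exists h.
  by rewrite /= invgM invgK bM.
rewrite /ysection/= inE /return_set/= invgM invgK bM => Sk.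
by exists k => //; split=> //; rewrite inE.
Qed.

Lemma occupation_continuous (K : set G) n (x : X) : compact K ->
  continuous (fun g : G => occupation K n (b g x)).
Proof.
move=> cK g.
have mK : measurable (K : set (borel G)).
  by apply: borel_closed; exact: compact_closed.
have mS : measurable (ysection (return_set n) x) by exact: (measurable_ysection _ (return_set_measurable n)).
pose gK (k : G) : set (borel G) := [set (k * h)%g | h in K].
pose Sx : set (borel G) := ysection (return_set n) x.
have mgK k : measurable (gK k) by exact: lcoset_measurable.
have fin k : mu (gK k `&` Sx) \is a fin_num.
  rewrite ge0_fin_numE//.
  apply: (le_lt_trans (measureIl mu (mgK k) mS)).
  exact: (haar_compact_lty haar_mu (@lcoset_compact G k _ cK)).
have le k k' : (mu (gK k `&` Sx) <= mu (gK k' `&` Sx) + mu (gK k `\` gK k'))%E.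
  have m1 : measurable (gK k' `&` Sx) by exact: measurableI.
  have m2 : measurable (gK k `\` gK k') by exact: measurableD.
  apply: (le_trans _ (measureU2 mu m1 m2)).
  apply: le_measure; rewrite ?inE; [exact: measurableI|exact: measurableU|].
  move=> z [kz Sz]; have [k'z|nk'z] := pselect (gK k' z); first by left.
  by right.
apply/cvgrPdist_lt => e e0.
have H := haar_translation_continuous lcscG haar_mu g^-1%g cK e0.
have : \forall g' \near g, (mu (gK g^-1%g `\` gK g'^-1%g) < e%:E)%E /\
    (mu (gK g'^-1%g `\` gK g^-1%g) < e%:E)%E := @invg_continuous G g _ H.
apply: filterS => g' [H1 H2].
rewrite !occupation_translate// -/(gK _) -/(gK _) -/Sx.
have := le g^-1%g g'^-1%g; have := le g'^-1%g g^-1%g.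
have F1 := fin g^-1%g; have F2 := fin g'^-1%g.
rewrite -[X in (_ <= X + _)%E](fineK F1) -[X in (X <= _)%E -> _](fineK F2).
move=> L1; rewrite -[X in (X <= _)%E](fineK F1) -[X in (_ <= X + _)%E](fineK F2) => L2.
set u := fine _ in L1 L2 *; set v := fine _ in L1 L2 *.
have L1' : (v%:E < u%:E + e%:E)%E by apply: (le_lt_trans L2); rewrite lteD2lE.
have L2' : (u%:E < v%:E + e%:E)%E by apply: (le_lt_trans L1); rewrite lteD2lE.
by move: L1' L2'; rewrite -!EFinD !lte_fin ltr_norml => *; apply/andP; split; lra.
Qed.

(** By uniqueness of measures on a pi-system, the sets of [h] sending [x] and [y]
    into [S n] under [h^-1] agree up to a null set, for each [n]. As Haar measure
    is not zero, some [h] avoids all these null sets; then [h^-1] sends [x] and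
    [y] to points that no [S n] separates. *)
Lemma occupation_separating (B : nat -> set G) (x y : X) : compact_basis B ->
  (forall p n, occupation (basic_compact B p) n x =
               occupation (basic_compact B p) n y) -> x = y.
Proof.
move=> bB oxy.
have mS n z : measurable (ysection (return_set n) z) by exact: (measurable_ysection _ (return_set_measurable n)).
have eqS n (A : set (borel G)) : measurable A ->
    mu (A `&` ysection (return_set n) x) = mu (A `&` ysection (return_set n) y).
  move=> mA.
  have bcover : \bigcup_i basic_compact B (i, [::]) = setT.
    apply/seteqP; split=> // z _; have [_ _ b3] := bB.
    have [i Biz _] := b3 z setT filterT.
    by exists i => // j; rewrite inE => /eqP ->; exact: subset_closure.
  have mbc p : measurable (basic_compact B p : set (borel G)).
    by apply: borel_closed; exact: basic_compact_closed.
  have muS p z : mu (basic_compact B p `&` ysection (return_set n) z) \is a fin_num.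
    rewrite ge0_fin_numE//; apply: le_lt_trans (measureIl mu (mbc p) (mS n z)) _.
    have cp : compact (basic_compact B p) by exact: basic_compact_compact.
    exact: (haar_compact_lty haar_mu cp).
  apply: (@g_sigma_algebra_measure_unique _ R (borel G) (range (basic_compact B)) _
    (fun i => basic_compact B (i, [::])) _ bcover
    (mrestr mu (mS n x)) (mrestr mu (mS n y))).
  - by move=> _ [p _ <-]; exact: mbc.
  - by move=> i; exists (i, [::]).
  - exact: basic_compactI.
  - move=> _ [p _ <-]; rewrite /= /mrestr -[LHS]fineK// -[RHS]fineK//.
    by congr (_%:E); exact: oxy.
  - by move=> k; rewrite /= /mrestr -ge0_fin_numE//; exact: muS.
  - exact: (borel_basic_compact bB mA).
pose D n : set (borel G) := (ysection (return_set n) x `\` ysection (return_set n) y) `|`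
  (ysection (return_set n) y `\` ysection (return_set n) x).
have mD n : measurable (D n) by apply: measurableU; exact: measurableD.
have D0 n : mu (D n) = 0%E.
  apply/eqP; rewrite eq_le measure_ge0 andbT.
  have m1 : measurable (ysection (return_set n) x `\` ysection (return_set n) y).
    exact: measurableD.
  have m2 : measurable (ysection (return_set n) y `\` ysection (return_set n) x).
    exact: measurableD.
  have e1 : mu (ysection (return_set n) x `\` ysection (return_set n) y) = 0%E.
    rewrite -(setIidl (A := _ `\` _) (B := ysection (return_set n) x)); last by move=> ? [].
    by rewrite eqS// setDE -setIA setICl setI0 measure0.
  have e2 : mu (ysection (return_set n) y `\` ysection (return_set n) x) = 0%E.
    rewrite -(setIidl (A := _ `\` _) (B := ysection (return_set n) y)); last by move=> ? [].
    by rewrite -eqS// setDE -setIA setICl setI0 measure0.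
  apply: (le_trans (measureU2 mu m1 m2)).
  change (mu (ysection (return_set n) x `\` ysection (return_set n) y) +
    mu (ysection (return_set n) y `\` ysection (return_set n) x) <= 0)%E.
  by rewrite e1 e2 adde0.
have [h Dh] : exists h, forall n, ~ D n h.
  apply: contrapT => nh; case: haar_mu => /eqP + _ _; apply.
  have -> : [set: G] = \bigcup_n D n.
    apply/seteqP; split=> // h _; apply: contrapT => Dh; apply: nh.
    by exists h => n Dnh; apply: Dh; exists n.
  apply/eqP; rewrite eq_le measure_ge0 andbT.
  apply: (@le_trans _ _ (\sum_(0 <= i <oo) mu (D i))%E).
    by apply: measure_sigma_subadditive => //; exact: bigcup_measurable.
  by rewrite eseries0// => i _ _; exact: D0.
have [b1 bM] := b_action.
suff hxy : b h^-1%g x = b h^-1%g y.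
  by rewrite -[x]b1 -[y]b1 -(mulgV h) !bM hxy.
apply: S_separating => n.
have inY z : ysection (return_set n) z h <-> S n (b h^-1%g z).
  by rewrite /ysection/= inE.
rewrite -!inY; split=> Hz; apply: contrapT => nHz; apply: (Dh n).
  by left.
by right.
Qed.

(** These coordinates take the place of a topology on [X] for which the action is
    continuous. *)
Theorem orbit_continuous_coordinates : exists c : nat -> X -> R,
  [/\ forall j, measurable_fun setT (c j),
      forall j x, continuous (fun g : G => c j (b g x)) &
      forall x y, (forall j, c j x = c j y) -> x = y].
Proof.
have [_ lG sG] := lcscG; have [B bB] := lcsc_compact_basis hG lG sG.
exists (fun m => if (@choice.unpickle ((nat * seq nat) * nat)%type m) is Some (p, n)
  then occupation (basic_compact B p) n else cst 0); split=> [m|m x|x y cxy].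
- case: choice.unpickle => [[p n]|]; last exact: measurable_cst.
  by apply: occupation_measurable; exact: basic_compact_compact.
- case: choice.unpickle => [[p n]|]; last by move=> g; exact: cvg_cst.
  by apply: occupation_continuous; exact: basic_compact_compact.
apply: (occupation_separating bB) => p n.
by have := cxy (@choice.pickle ((nat * seq nat) * nat)%type (p, n)); rewrite choice.pickleK.
Qed.

End topological_model.

(** * Almost everywhere properties and point masses *)

Section almost_everywhere.
Variables (R : realType) (d : measure_display) (X : measurableType d).
Variable m : probability X R.

Lemma ae_prob1 (E : set X) : measurable E -> m E = 1%E -> \forall x \ae m, E x.
Proof.
move=> mE E1; exists (~` E); split => //; first exact: measurableC.
by rewrite probability_setC// E1 subee.
Qed.

Lemma ae_prob0 (E : set X) : measurable E -> m E = 0%E -> \forall x \ae m, ~ E x.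
Proof. by move=> mE E0; exists E; split => // x /= /contrapT. Qed.

Lemma prob1_ae (E : set X) : measurable E -> (\forall x \ae m, E x) -> m E = 1%E.
Proof.
move=> mE [A [mA A0 EA]].
have := probability_setC m (measurableC mE); rewrite setCK => ->.
suff -> : m (~` E) = 0%E by rewrite sube0.
by apply: subset_measure0 A0 => //; exact: measurableC.
Qed.

Lemma ae_exists (P : set X) : (\forall x \ae m, P x) -> exists x, P x.
Proof.
move=> [A [mA A0 PA]]; apply: contrapT => nP.
have AT : A = setT by apply/seteqP; split=> // x _; apply: PA => /= Px; apply: nP; exists x.
by move: A0; rewrite AT probability_setT => /eqP; rewrite onee_eq0.
Qed.

Lemma ae_preimage (f : X -> X) (P : set X) : measurable_fun setT f ->
  (forall A, measurable A -> m (f @^-1` A) = m A) ->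
  (\forall x \ae m, P x) -> \forall x \ae m, P (f x).
Proof.
move=> mf mpf [A [mA A0 PA]]; exists (f @^-1` A); split.
- by rewrite -[X in measurable X]setTI; exact: mf.
- by rewrite mpf.
- by move=> x nPx; exact: PA.
Qed.

End almost_everywhere.

Section zero_one.
Variables (R : realType) (d : measure_display) (X : measurableType d).
Variable m : probability X R.
Variable c : nat -> X -> R.
Hypotheses (c_measurable : forall j, measurable_fun setT (c j))
  (c_separating : forall x y, (forall j, c j x = c j y) -> x = y).

Lemma measurable_coordinate_lt j (q : R) : measurable [set x | c j x < q].
Proof.
have mq : measurable_fun setT (fun x => c j x < q).
  by apply: measurable_fun_ltr => //; exact: measurable_cst.
have := mq measurableT [set true] I; rewrite setTI.
by congr measurable; apply/seteqP.
Qed.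

Lemma coordinate_eq_measurable (f : X -> X) : measurable_fun setT f ->
  measurable [set x | f x = x].
Proof.
move=> mf; have -> : [set x | f x = x] = \bigcap_j [set x | c j (f x) == c j x].
  apply/seteqP; split=> [x fx j _|x H]; first by rewrite /= fx.
  by apply: c_separating => j; apply/eqP; exact: H.
apply: bigcapT_measurable => j.
have := measurable_fun_eqr (measurableT_comp (c_measurable j) mf) (c_measurable j).
move=> /(_ measurableT [set true] I); rewrite setTI.
by congr measurable; apply/seteqP.
Qed.

(** Each set [c j < q] with [q] rational has measure [0] or [1], so the value of
    each coordinate is almost surely determined. *)
Lemma zero_one_dirac :
  (forall A, measurable A -> m A = 0%E \/ m A = 1%E) ->
  exists x0, \forall x \ae m, x = x0.
Proof.
move=> m01.
pose E (j : nat) (q : rat) := [set x | c j x < ratr q].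
have mE j q : measurable (E j q) by exact: measurable_coordinate_lt.
pose F j q x := E j q x <-> m (E j q) = 1%E.
have aeF : \forall x \ae m, forall n, if (@choice.unpickle (nat * rat)%type n) is Some (j, q)
    then F j q x else True.
  apply: ae_foralln => n; case: choice.unpickle => [[j q]|]; last exact: aeW.
  have [E0|E1] := m01 _ (mE j q).
    apply: filterS (ae_prob0 (mE j q) E0) => x nEx; split=> // E1.
    by move: E0; rewrite E1 => /eqP; rewrite onee_eq0.
  by apply: filterS (ae_prob1 (mE j q) E1) => x Ex; split.
have aeF' : \forall x \ae m, forall j q, F j q x.
  apply: filterS aeF => x H j q.
  by have := H (@choice.pickle (nat * rat)%type (j, q)); rewrite choice.pickleK.
have [x0 Fx0] := ae_exists aeF'.
exists x0; apply: filterS aeF' => x Fx; apply: c_separating => j.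
have lt y z : (forall j q, F j q y) -> (forall j q, F j q z) -> ~ c j y < c j z.
  move=> Fy Fz yz; have [q] := rat_in_itvoo yz.
  rewrite in_itv/= => /andP[yq qz].
  have : E j q z by apply/(Fz j q)/(Fy j q).
  by rewrite /E/= ltNge (ltW qz).
by apply/eqP; rewrite eq_le !leNgt; apply/andP; split; apply/negP; exact: lt.
Qed.

(** The points fixed by the whole group form a set of full measure, all of whose
    measurable subsets are invariant; ergodicity then leaves only the measures
    [0] and [1]. The sequence [dn] makes this set measurable, being a countable
    intersection of sets of fixed points. *)
Lemma ergodic_trivial_dirac (H : groupType) (b : H -> X -> X) (dn : nat -> H) :
  is_group_action b -> (forall h, measurable_fun setT (b h)) ->
  (forall x, (forall k, b (dn k) x = x) -> forall h, b h x = x) ->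
  ergodic m b -> (forall h, \forall x \ae m, b h x = x) ->
  exists x0, \forall x \ae m, x = x0.
Proof.
move=> [b1 bM] mb dense erg triv; apply: zero_one_dirac => A mA.
pose X0 := [set x | forall h, b h x = x].
have X0E : X0 = \bigcap_k [set x | b (dn k) x = x].
  by apply/seteqP; split=> [x fx k _|x fx]; [exact: fx|apply: dense => k; exact: fx].
have mX0 : measurable X0.
  by rewrite X0E; apply: bigcapT_measurable => k; exact: coordinate_eq_measurable.
have aeX0 : \forall x \ae m, X0 x.
  apply: filterS (ae_foralln (fun k => triv (dn k))) => x fx.
  by apply: dense.
have -> : m A = m (A `&` X0).
  have mAX := prob1_ae mX0 aeX0.
  apply/eqP; rewrite eq_le; apply/andP; split; last exact: measureIl.
  rewrite (measureDI m mA mX0) -[leRHS]add0e leeD//.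
  have := probability_setC m mX0; rewrite mAX subee// => <-.
  apply: le_measure; rewrite ?inE; [exact: measurableD|exact: measurableC|].
  by move=> x [].
apply: erg; first exact: measurableI.
move=> h; apply/seteqP; split=> x [Ax X0x]; last by rewrite /= X0x.
have xx : b h x = x.
  by have := X0x h^-1%g; rewrite -bM mulVg b1.
by move: Ax X0x; rewrite xx.
Qed.

End zero_one.

(** * Stabilizers of an irreducible action *)

Lemma near_forall_lt (T : topologicalType) (x : T) (P : nat -> T -> Prop) N :
  (forall l, \forall y \near x, P l y) ->
  \forall y \near x, forall l, (l < N)%N -> P l y.
Proof.
move=> nP; elim: N => [|N ih]; first exact: nearW.
apply: filterS (filterI (nP N) ih) => y [PN H] l.
by rewrite ltnS leq_eqVlt => /orP[/eqP ->//|]; exact: H.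
Qed.

Section dichotomy.
Variables (R : realType) (G1 G2 : topologicalGroupType).
Hypotheses (G1_lcsc : lcsc G1) (G1_simple : simple_tgroup G1)
  (G1_nonamenable : ~ amenable R G1)
  (G2_discrete : forall A : set G2, open A)
  (G2_countable : countable [set: G2]) (G2_simple : simple_tgroup G2).
Variables (d : measure_display) (X : measurableType d) (m : probability X R).
Variable a : G1 * G2 -> X -> X.
Hypotheses (a_action : is_group_action a)
  (a_measurable : forall g, measurable_fun setT (a g))
  (a_mp : measure_preserving m a) (a_irr : irreducible m a).
Variable c : nat -> X -> R.
Hypotheses (c_measurable : forall j, measurable_fun setT (c j))
  (c_continuous : forall j x, continuous (fun g : G1 => c j (a (g, 1%g) x)))
  (c_separating : forall x y, (forall j, c j x = c j y) -> x = y).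
Variable B : nat -> set G1.
Hypothesis bB : compact_basis B.

Let hG1 : hausdorff_space G1. Proof. by case: G1_lcsc. Qed.

Let a1 x : a (1%g, 1%g) x = x. Proof. by case: a_action. Qed.

Let aM g g' h h' x : a ((g * g')%g, (h * h')%g) x = a (g, h) (a (g', h') x).
Proof. by case: a_action => _ <-. Qed.

Let split12 g h x : a (g, h) x = a (g, 1%g) (a (1%g, h) x).
Proof. by rewrite -aM mulg1 mul1g. Qed.

Let split21 g h x : a (g, h) x = a (1%g, h) (a (g, 1%g) x).
Proof. by rewrite -aM mulg1 mul1g. Qed.

(** Whether these sets contain [x], for all [i], determines the part of the
    stabilizer of [x] that lies above [h], as this part is closed. *)
Definition fixed_by_cell i (h : G2) : set X :=
  [set x | exists2 g, closure (B i) g & a (g, h) x = x].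

Let dn k : G1 := get (B k).

Let dnP k g : B k g -> B k (dn k).
Proof. by move=> Bkg; apply: (@getI _ (B k) g). Qed.

Lemma orbit_closed x y : closed [set g : G1 | a (g, 1%g) x = y].
Proof.
have -> : [set g : G1 | a (g, 1%g) x = y] =
    \bigcap_j ((fun g => c j (a (g, 1%g) x)) @^-1` [set c j y]).
  apply/seteqP; split=> [g gx j _|g H]; first by rewrite /= gx.
  by apply: c_separating => j; exact: H.
apply: closed_bigI => j _; apply: preimage_closed => [g _|].
  exact: c_continuous.
exact: accessible_closed_set1 (hausdorff_accessible (@Rhausdorff R)) _.
Qed.

Lemma dense_fixed x : (forall k, a (dn k, 1%g) x = x) -> forall g, a (g, 1%g) x = x.
Proof.
move=> fx g; apply: (@orbit_closed x x) => V gV; have [_ _ b3] := bB.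
have [i Big BiV] := b3 g V gV.
by exists (dn i); split=> //; apply: BiV; apply: subset_closure; exact: dnP Big.
Qed.

(** By compactness, an element of [closure (B i)] fixes [x] with [h] as soon as
    elements of the sequence [dn] in [B i] do so up to an arbitrarily small error
    on arbitrarily many coordinates; this only involves countable operations. *)
Lemma fixed_by_cell_measurable i h : measurable (fixed_by_cell i h).
Proof.
pose near_fix N k x := B i (dn k) /\
  forall l, (l < N)%N -> `|c l (a (dn k, h) x) - c l x| < N.+1%:R^-1.
have -> : fixed_by_cell i h = \bigcap_N \bigcup_k [set x | near_fix N k x].
  have [b1 b2 b3] := bB.
  apply/seteqP; split=> x.
    move=> [g Big gx] N _.
    pose V := [set g' | forall l, (l < N)%N -> `|c l (a (g', h) x) - c l x| < N.+1%:R^-1].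
    have gV : nbhs g V.
      apply: (near_forall_lt (P := fun l g' => `|c l (a (g', h) x) - c l x| < N.+1%:R^-1)) => l.
      have N0 : 0 < N.+1%:R^-1 :> R by rewrite invr_gt0.
      have /cvgrPdist_lt/(_ _ N0) := @c_continuous l (a (1%g, h) x) g.
      by apply: filterS => g'; rewrite distrC -!split12 gx.
    have [g' [Big' Vg']] := Big _ (nbhs_interior gV).
    have oBV : nbhs g' (B i `&` V°).
      by apply: open_nbhs_nbhs; split=> //; apply: openI => //; exact: open_interior.
    have [k Bkg' Bk] := b3 g' _ oBV.
    have [Bi Vk] := Bk _ (subset_closure (dnP Bkg')).
    by exists k => //; split => //; exact: interior_subset Vk.
  move=> H; have {}H N : exists k, near_fix N k x by have [k _ ?] := H N I; exists k.
  have [k Hk] := choice H.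
  have FF : ProperFilter ((fun n => dn (k n)) @ \oo) by apply: fmap_proper_filter.
  have [|g [Big clg]] := b2 i _ FF.
    by exists 0%N => // n _ /=; apply: subset_closure; exact: (Hk n).1.
  exists g => //; apply: c_separating => l; apply/eqP.
  rewrite -subr_eq0 -normr_le0; apply/ler_addgt0Pr => e e0; rewrite add0r.
  have e2 : 0 < e / 2 by rewrite divr_gt0.
  have /cvgrPdist_lt/(_ _ e2) gV := @c_continuous l (a (1%g, h) x) g.
  have nF : ((fun n => dn (k n)) @ \oo) [set g' | exists n, [/\ (l < n)%N,
      n.+1%:R^-1 < e / 2 & g' = dn (k n)]].
    have lF : \forall n \near \oo, (l < n)%N by exists l.+1.
    apply: filterS (filterI lF (near_infty_natSinv_lt (PosNum e2))) => n [ln ne].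
    by exists n; split.
  have [g' [[n [ln ne ->]] Vn]] := clg _ _ nF gV.
  move: Vn => /=; rewrite -!split12 => Vn.
  have Hn := (Hk n).2 l ln.
  rewrite -(subrKA (c l (a (dn (k n), h) x))) (le_trans (ler_normD _ _))//.
  rewrite [leRHS](splitr e) lerD//; first exact: ltW.
  by rewrite ltW// (lt_trans Hn).
apply: bigcapT_measurable => N; apply: bigcupT_measurable => k.
have [Bik|nBik] := pselect (B i (dn k)); last first.
  rewrite (_ : mkset _ = set0); first exact: measurable0.
  by apply/seteqP; split=> // x [].
rewrite (_ : mkset _ = \bigcap_l (if (l < N)%N then
  [set x | `|c l (a (dn k, h) x) - c l x| < N.+1%:R^-1] else setT)); last first.
  apply/seteqP; split=> [x [_ H] l _|x H]; first by case: ifP => // /H.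
  by split=> // l lN; have := H l I; rewrite lN.
apply: bigcapT_measurable => l; case: ifP => _; last exact: measurableT.
have mq : measurable_fun setT (fun x => `|c l (a (dn k, h) x) - c l x| < N.+1%:R^-1).
  apply: measurable_fun_ltr; last exact: measurable_cst.
  apply: measurableT_comp => //; apply: measurable_funB => //.
  exact: measurableT_comp.
have := mq measurableT [set true] I; rewrite setTI.
by congr measurable; apply/seteqP.
Qed.

Let ae_act g (P : set X) : (\forall x \ae m, P x) -> \forall x \ae m, P (a g x).
Proof. exact: ae_preimage (a_measurable g) (a_mp g). Qed.

Let act1 : is_group_action (fun g : G1 => a (g, 1%g)).
Proof. by split=> [x|g h x]; [exact: a1|rewrite -aM mulg1]. Qed.

Let act2 : is_group_action (fun h : G2 => a (1%g, h)).
Proof. by split=> [x|g h x]; [exact: a1|rewrite -aM mulg1]. Qed.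

Let a1V g x : a (g^-1%g, 1%g) (a (g, 1%g) x) = x.
Proof. by rewrite -aM mulVg mulg1 a1. Qed.

Let a2V h x : a (1%g, h^-1%g) (a (1%g, h) x) = x.
Proof. by rewrite -aM mulVg mulg1 a1. Qed.

Hypothesis not_dirac : ~ exists x0, \forall x \ae m, x = x0.

(** Otherwise ergodicity of this factor alone would make [m] a point mass. *)
Lemma G1_not_trivial : ~ forall g, \forall x \ae m, a (g, 1%g) x = x.
Proof.
move=> triv; apply: not_dirac; case: a_irr => erg1 _.
apply: (ergodic_trivial_dirac c_measurable c_separating act1 _ dense_fixed erg1 triv).
by move=> h; exact: a_measurable.
Qed.

Lemma G2_not_trivial : ~ forall h, \forall x \ae m, a (1%g, h) x = x.
Proof.
move=> triv; apply: not_dirac; case: a_irr => _ erg2.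
have [en enP] := countable_seqP G2_countable.
apply: (ergodic_trivial_dirac c_measurable c_separating act2 _ _ erg2 triv (dn := en)).
  by move=> h; exact: a_measurable.
by move=> x fx h; have [k _ <-] := enP h I.
Qed.

Lemma G2_subset_normal (N : set G2) : N 1%g ->
  (forall x y, N x -> N y -> N (x * y)%g) -> (forall x, N x -> N x^-1%g) ->
  (forall x g, N x -> N (x ^ g)%g) -> N = [set 1%g] \/ N = setT.
Proof.
move=> N1 NM NV NJ.
have clN : closed N by rewrite -[N]setCK; apply: open_closedC; exact: G2_discrete.
exact: (G2_simple (normal_csubP (N := ClosedSubgroup clN N1 NM NV) NJ)).
Qed.

(** The fixed points of [h] form a set invariant under [G1], of measure [0] or
    [1]; those [h] for which it is [1] form a proper normal subgroup, so there is
    none but [1]. *)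
Lemma G2_free (h : G2) : h != 1%g -> \forall x \ae m, a (1%g, h) x <> x.
Proof.
move=> h1; pose N := [set h : G2 | \forall x \ae m, a (1%g, h) x = x].
have mfix h' : measurable [set x | a (1%g, h') x = x].
  exact: (coordinate_eq_measurable c_measurable c_separating).
have [||||NE|NT] := @G2_subset_normal N.
- by apply: aeW => x; exact: a1.
- move=> x y Nx Ny; apply: filterS (filterI Nx Ny) => z [xz yz].
  by rewrite -{1}(mulg1 1%g) aM yz.
- move=> x; apply: filterS => z xz.
  by rewrite -{1}xz a2V.
- move=> x g Nx; apply: filterS (ae_act (1%g, g) Nx) => z H.
  by rewrite conjgE -(mulg1 1%g) -{2}(mulg1 1%g) !aM H a2V.
- case: a_irr => erg1 _.
  have [|E0|E1] := erg1 _ (mfix h).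
  + move=> g; apply/seteqP; split=> x /= fx.
      have H : a (g^-1%g, 1%g) (a (1%g, h) (a (g, 1%g) x)) = a (1%g, h) x.
        by rewrite -split12 split21 a1V.
      by rewrite -H fx a1V.
    by rewrite -split21 split12 fx.
  + exact: (ae_prob0 (mfix h) E0).
  + have : N h by apply: ae_prob1 E1.
    by rewrite NE => /= hE; rewrite hE eqxx in h1.
- by exfalso; apply: G2_not_trivial => h'; have : N h' by rewrite NT.
Qed.

Lemma G2_nontrivial : exists h : G2, h != 1%g.
Proof.
apply: contrapT => nh; apply: G2_not_trivial => h.
have -> : h = 1%g by apply/eqP/negP => /negP h1; apply: nh; exists h.
by apply: aeW => x; exact: a1.
Qed.

Let fixM y g g' : a (g, 1%g) y = y -> a (g', 1%g) y = y -> a ((g * g')%g, 1%g) y = y.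
Proof. by move=> gy g'y; rewrite -{1}(mulg1 1%g) aM g'y. Qed.

Let fixV y g : a (g, 1%g) y = y -> a (g^-1%g, 1%g) y = y.
Proof. by move=> gy; rewrite -{1}gy a1V. Qed.

Definition G1_stabilizer y : closedSubgroup G1 :=
  ClosedSubgroup (@orbit_closed y y) (a1 y) (@fixM y) (@fixV y).

(** The events that the stabilizer in [G1] meets [closure (B i)] are invariant
    under [G2], hence almost surely constant, and they determine this closed
    subgroup. It is thus almost surely equal to a fixed subgroup, which is normal
    because moving the point by [k] conjugates its stabilizer. *)
Lemma G1_free : \forall x \ae m, forall g, a (g, 1%g) x = x -> g = 1%g.
Proof.
have [b1 b2 b3] := bB.
have mF i := fixed_by_cell_measurable i 1%g.
have F01 i : m (fixed_by_cell i 1%g) = 0%E \/ m (fixed_by_cell i 1%g) = 1%E.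
  case: a_irr => _; apply=> // h; apply/seteqP; split=> x [g Big gx]; exists g => //.
    have H : a (1%g, h^-1%g) (a (g, 1%g) (a (1%g, h) x)) = a (g, 1%g) x.
      by rewrite -split21 split12 a2V.
    by rewrite -H gx a2V.
  by rewrite -split12 split21 gx.
have good : \forall x \ae m, forall i, fixed_by_cell i 1%g x <-> m (fixed_by_cell i 1%g) = 1%E.
  apply: ae_foralln => i; have [E0|E1] := F01 i.
    apply: filterS (ae_prob0 (mF i) E0) => x nEx; split=> // E1.
    by move: E0; rewrite E1 => /eqP; rewrite onee_eq0.
  by apply: filterS (ae_prob1 (mF i) E1) => x Ex; split.
have sameN y : (forall i, fixed_by_cell i 1%g y <-> m (fixed_by_cell i 1%g) = 1%E) ->
    forall x, (forall i, fixed_by_cell i 1%g x <-> m (fixed_by_cell i 1%g) = 1%E) ->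
    forall g, a (g, 1%g) x = x -> a (g, 1%g) y = y.
  move=> Hy x Hx g gx; apply: (@orbit_closed y y) => V gV.
  have [i Big BiV] := b3 g V gV.
  have [g' Big' g'y] : fixed_by_cell i 1%g y.
    by apply/Hy/Hx; exists g => //; exact: subset_closure.
  by exists g'; split=> //; exact: BiV.
have [y Hy] := ae_exists good.
have nor : normal_csub (G1_stabilizer y).
  apply: normal_csubP => g k /= gy.
  have [x [Hx Hkx]] := ae_exists (filterI good (ae_act (k, 1%g) good)).
  apply: (sameN y Hy x Hx).
  have := sameN _ Hkx _ Hy _ gy => H.
  by rewrite conjgE -(mulg1 1%g) -{2}(mulg1 1%g) !aM H a1V.
have [N1|NT] := G1_simple nor.
  apply: filterS good => x Hx g gx.
  have : (G1_stabilizer y : set G1) g by exact: (sameN y Hy x Hx).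
  by rewrite N1.
exfalso; apply: G1_not_trivial => g; apply: filterS good => x Hx.
apply: (sameN x Hx y Hy).
by have : (G1_stabilizer y : set G1) g by rewrite NT.
Qed.

Definition stabilizer_above (h : G2) : set X := [set x | exists g, a (g, h) x = x].

Lemma stabilizer_above_measurable h : measurable (stabilizer_above h).
Proof.
have -> : stabilizer_above h = \bigcup_i fixed_by_cell i h.
  apply/seteqP; split=> [x [g gx]|x [i _ [g _ gx]]]; last by exists g.
  have [_ _ b3] := bB; have [i Big _] := b3 g setT filterT.
  by exists i => //; exists g => //; exact: subset_closure.
by apply: bigcupT_measurable => i; exact: fixed_by_cell_measurable.
Qed.

Lemma stabilizer_above_prob01 h : m (stabilizer_above h) = 0%E \/ m (stabilizer_above h) = 1%E.
Proof.
case: a_irr => erg1 _; apply: erg1; first exact: stabilizer_above_measurable.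
move=> k; apply/seteqP; split=> x [g gx].
  exists (g ^ k)%g.
  by rewrite conjgE -(mul1g h) -(mulg1 h) !aM gx a1V.
exists (g ^ k^-1)%g.
by rewrite conjgE invgK -(mul1g h) -(mulg1 h) !aM a1V gx.
Qed.

(* Above [h], the stabilizer of these points consists of a single element
   [(graph_map h x, h)], so that choosing it is a measurable operation. *)
Let graph_points h : set X :=
  stabilizer_above h `&` [set x | forall g, a (g, 1%g) x = x -> g = 1%g].

Let graph_points_measurable h : measurable (graph_points h).
Proof.
apply: measurableI; first exact: stabilizer_above_measurable.
have -> : [set x | forall g, a (g, 1%g) x = x -> g = 1%g] =
    \bigcap_i (if `[< closure (B i) `<=` ~` [set 1%g] >] then ~` fixed_by_cell i 1%g else setT).
  apply/seteqP; split=> [x Hx i _|x Hx g gx].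
    by case: asboolP => // B1 [g Big gx]; apply: (B1 g Big); exact: Hx.
  apply: contrapT => g1; have [_ _ b3] := bB.
  have o1 : open (~` [set (1%g : G1)]).
    by apply: closed_openC; apply: compact_closed => //; exact: compact_set1.
  have [i Big B1] := b3 g _ (open_nbhs_nbhs (conj o1 g1)).
  have := Hx i I; case: asboolP => // _; apply; exists g => //.
  exact: subset_closure.
apply: bigcapT_measurable => i; case: ifP => _; last exact: measurableT.
by apply: measurableC; exact: fixed_by_cell_measurable.
Qed.

Let graph_points_unique h x g g' : graph_points h x ->
  a (g, h) x = x -> a (g', h) x = x -> g = g'.
Proof.
move=> [_ free] gx g'x; apply/esym; rewrite -[LHS](mulVKg g).
rewrite (free (g^-1 * g')%g) ?mulg1// -{1}(mulVg h) aM g'x.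
by rewrite -{1}gx -aM !mulVg a1.
Qed.

Let conj_fixed h k g x : a (g, h) x = x ->
  a ((g ^ k^-1)%g, h) (a (k, 1%g) x) = a (k, 1%g) x.
Proof.
by move=> gx; rewrite conjgE invgK -(mul1g h) -(mulg1 h) !aM a1V gx.
Qed.

Let graph_points_act h k x : graph_points h x -> graph_points h (a (k, 1%g) x).
Proof.
move=> [[g gx] free]; split; first by exists (g ^ k^-1)%g; exact: conj_fixed.
move=> g' g'kx; have : (g' ^ k)%g = 1%g.
  apply: free; have := @conj_fixed 1%g k^-1%g g' _ g'kx.
  by rewrite invgK a1V.
by move=> /(congr1 (fun z => (z ^ k^-1)%g)); rewrite conjgK conj1g.
Qed.

Let graph_map h (x : X) : borel G1 :=
  if pselect (graph_points h x) is left _ then get [set g | a (g, h) x = x] else 1%g.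

Let graph_mapP h x : graph_points h x -> a (graph_map h x, h) x = x.
Proof.
rewrite /graph_map; case: pselect => // -[[g gx] _] _.
exact: (@getI _ [set g | a (g, h) x = x] g).
Qed.

Let graph_map_out h x : ~ graph_points h x -> graph_map h x = 1%g.
Proof. by rewrite /graph_map; case: pselect. Qed.

Let graph_map_conj h k x : graph_map h (a (k, 1%g) x) = (graph_map h x ^ k^-1)%g.
Proof.
have [gx|ngx] := pselect (graph_points h x).
  have gkx := graph_points_act k gx.
  apply: (graph_points_unique gkx (graph_mapP gkx)).
  by apply: conj_fixed; exact: graph_mapP.
rewrite !graph_map_out ?conj1g// => gkx; apply: ngx.
by have := graph_points_act k^-1%g gkx; rewrite a1V.
Qed.

Let graph_map_measurable h : measurable_fun setT (graph_map h).
Proof.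
have [b1 b2 b3] := bB.
apply: (@measurability _ _ X (borel G1) setT (graph_map h) (@open G1)) => //.
move=> _ [U oU <-]; rewrite setTI (compact_basis_bigcup bB oU) bigcup_mkcond.
rewrite preimage_bigcup; apply: bigcupT_measurable => i.
case: ifP => _; last by rewrite preimage_set0; exact: measurable0.
have -> : graph_map h @^-1` closure (B i) = (graph_points h `&` fixed_by_cell i h) `|`
    (if `[< closure (B i) 1%g >] then ~` graph_points h else set0).
  apply/seteqP; split=> [x /= Bx|x [[gx [g Big gxx]]|]].
  - have [gx|ngx] := pselect (graph_points h x).
      by left; split=> //; exists (graph_map h x) => //; exact: graph_mapP.
    by right; move: Bx; rewrite graph_map_out// => Bx; case: asboolP.
  - by rewrite /= (graph_points_unique gx (graph_mapP gx) gxx).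
  - by case: asboolP => // B1 ngx; rewrite /= graph_map_out.
apply: measurableU; first by apply: measurableI => //; exact: fixed_by_cell_measurable.
by case: ifP => _; [exact: measurableC|exact: measurable0].
Qed.

(** Otherwise [graph_map h0] would be defined almost everywhere, and its law would
    be a conjugation-invariant probability on [G1] without mass at [1]. *)
Lemma stabilizer_above_neq1 (h0 : G2) : h0 != 1%g ->
  m (stabilizer_above h0) <> 1%E.
Proof.
move=> h01 P1; apply: G1_nonamenable.
pose phi : {mfun X >-> borel G1} :=
  HB.pack (graph_map h0) (isMeasurableFun.Build _ _ _ _ _ (graph_map_measurable h0)).
pose lam : probability (borel G1) R := distribution m phi.
apply: (@amenable_of_conj_invariant R G1 lam) => //.
- move=> g A mA; rewrite /lam /= /distribution /pushforward /=.
  have mpA : measurable (graph_map h0 @^-1` A).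
    by rewrite -[X in measurable X]setTI; exact: graph_map_measurable.
  rewrite -(a_mp (g^-1%g, 1%g) mpA); congr (m _).
  by apply/seteqP; split=> x /=; rewrite graph_map_conj invgK.
- rewrite /lam /= /distribution /pushforward /=.
  have m1 : measurable ([set 1%g] : set (borel G1)).
    by apply: borel_closed; apply: compact_closed => //; exact: compact_set1.
  have mp1 : measurable (graph_map h0 @^-1` [set 1%g]).
    by rewrite -[X in measurable X]setTI; exact: graph_map_measurable.
  have : \forall x \ae m, ~ (graph_map h0 @^-1` [set 1%g]) x.
    have pr := ae_prob1 (stabilizer_above_measurable h0) P1.
    apply: filterS (filterI (filterI pr G1_free) (G2_free h01)) => x [[px fx] nx] /= ph.
    by apply: nx; rewrite -{1}ph; apply: graph_mapP.
  move=> [N [mN N0 NE]]; apply: subset_measure0 N0 => // x fx.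
  by apply: NE => /= /(_ fx).
Qed.

(** The elements [h] of [G2] above which almost every stabilizer contains a point
    form a normal subgroup, which is not [G2] by [stabilizer_above_neq1]. So
    almost every stabilizer lies in [G1], where it is trivial. *)
Lemma essentially_free_of_not_dirac :
  \forall x \ae m, stabilizer a x = [set 1%g].
Proof.
pose N := [set h : G2 | \forall x \ae m, stabilizer_above h x].
have [||||NE|NT] := @G2_subset_normal N.
- by apply: aeW => x; exists 1%g; exact: a1.
- move=> x y Nx Ny; apply: filterS (filterI Nx Ny) => z [[g gz] [g' g'z]].
  by exists (g * g')%g; rewrite aM g'z.
- move=> x; apply: filterS => z [g gz]; exists g^-1%g.
  by rewrite -{1}gz -aM !mulVg a1.
- move=> x k Nx; apply: filterS (ae_act (1%g, k) Nx) => z [g gz]; exists g.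
  by rewrite conjgE -{1}(mul1g g) -{1}(mulg1 g) !aM gz a2V.
- have [en enP] := countable_seqP G2_countable.
  have G2F : \forall x \ae m, forall n, stabilizer_above (en n) x -> en n = 1%g.
    apply: ae_foralln => n.
    have [-> |n1] := eqVneq (en n) 1%g; first exact: aeW.
    have [E0|E1] := stabilizer_above_prob01 (en n).
      by apply: filterS (ae_prob0 (stabilizer_above_measurable _) E0).
    have : N (en n) by apply: ae_prob1 E1; exact: stabilizer_above_measurable.
    by rewrite NE => /= e; rewrite e eqxx in n1.
  apply: filterS (filterI G1_free G2F) => x [F1 F2]; apply/seteqP; split=> [[g h] /= gx|_ ->].
    have h1 : h = 1%g.
      by move: gx; have [n _ <-] := enP h I => gx; apply: F2; exists g.
    by move: gx; rewrite h1 => /F1 ->.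
  exact: a1.
- have [h h1] := G2_nontrivial; exfalso; apply: (stabilizer_above_neq1 h1).
  apply: prob1_ae; first exact: stabilizer_above_measurable.
  by have : N h by rewrite NT.
Qed.

End dichotomy.

(** * The space of closed subgroups *)

Section chabauty_topology.
Variable G : topologicalGroupType.

Lemma chabauty_subbase_open (S : set (closedSubgroup G)) :
  chabauty_subbase (G := G) S -> open S.
Proof.
move=> DS; exists [set S]; last by rewrite bigcup_set1.
by move=> _ ->; exact: (@finI_from1 _ _ (chabauty_subbase (G := G)) id).
Qed.

Lemma chabauty_continuous (f : closedSubgroup G -> closedSubgroup G) :
  (forall S, chabauty_subbase (G := G) S -> open (f @^-1` S)) -> continuous f.
Proof.
move=> fS; apply/continuousP => A [D' sD <-]; rewrite preimage_bigcup.
apply: bigcup_open => S /sD[F sF <-]; rewrite preimage_bigcap.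
rewrite bigcap_fset big_seq; apply: (big_ind open); first exact: openT.
  by move=> ? ? ? ?; exact: openI.
by move=> T FT; apply: fS; apply: set_mem; exact: sF.
Qed.

Lemma chabauty_hit_open (U : set G) : open U ->
  open [set H : closedSubgroup G | (H : set G) `&` U !=set0].
Proof. by move=> oU; apply: chabauty_subbase_open; right; exists U. Qed.

Lemma conj_csub_continuous (g : G) : continuous (@conj_csub G g).
Proof.
have cg := @conjg_continuous G g; have cgV := @conjg_continuous G g^-1%g.
apply: chabauty_continuous => S [[C cC <-]|[U oU <-]].
  apply: chabauty_subbase_open; left; exists [set (x ^ g)%g | x in C].
    by apply: continuous_compact => //; exact: continuous_subspaceT.
  apply/seteqP; split=> H /= HC; apply/seteqP; split=> // x.
    move=> [Hxg Cx]; suff : ((H : set G) `&` [set (x ^ g)%g | x in C]) (x ^ g)%g by rewrite HC.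
    by split=> //; exists x.
  move=> [Hx [y Cy yx]]; suff : (conj_set g H `&` C) y by rewrite HC.
  by split=> //; rewrite /conj_set/= yx.
rewrite (_ : _ @^-1` _ = [set H : closedSubgroup G |
    (H : set G) `&` [set x | U (x ^ g^-1)%g] !=set0]).
  by apply: chabauty_hit_open; apply: open_comp => // x _; exact: cgV.
apply/seteqP; split=> H /= [x [Hx Ux]].
  by exists (x ^ g)%g; split=> //=; rewrite conjgK.
by exists (x ^ g^-1)%g; split=> //; rewrite /= /conj_set/= conjgKV.
Qed.

Lemma conj_csub_action : is_group_action (@conj_csub G).
Proof.
split=> [H|g h H]; apply: closedSubgroup_eq; apply/seteqP.
  by split=> x; rewrite /= /conj_set/= conjg1.
by split=> x; rewrite /= /conj_set/= conjgM.
Qed.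

Lemma conj_csub_self (H : closedSubgroup G) (h : G) : (H : set G) h -> conj_csub h H = H.
Proof.
move=> Hh; apply: closedSubgroup_eq; apply/seteqP; split=> x; rewrite /= /conj_set/=.
  move=> Hxh; rewrite -(conjgK h x) conjgE invgK.
  by apply: csubM => //; apply: csubM => //; exact: csubV.
move=> Hx; rewrite conjgE; apply: csubM; first exact: csubV.
exact: csubM.
Qed.

End chabauty_topology.

Lemma countable_open_basis (T : ptopologicalType) :
  (forall A : set T, open A) -> countable [set: T] ->
  exists B : nat -> set T, open_basis B.
Proof.
move=> oT cT; have [en enP] := countable_seqP cT.
exists (fun n => [set en n]); split=> // x W /nbhs_singleton Wx.
by have [n _ nx] := enP x I; exists n; rewrite nx // => _ ->.
Qed.

Lemma prod_open_basis (T T' : topologicalType) (B : nat -> set T) (B' : nat -> set T') :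
  open_basis B -> open_basis B' -> exists C : nat -> set (T * T'), open_basis C.
Proof.
move=> [oB bB] [oB' bB'].
exists (fun n => if (@choice.unpickle (nat * nat)%type n) is Some (i, j) then B i `*` B' j else set0).
split=> [n|[x x'] W [[V V'] /= [xV xV'] VW]].
  case: choice.unpickle => [[i j]|]; last exact: open0.
  by apply: (openI (A := fst @^-1` B i) (B := snd @^-1` B' j)); apply: open_comp => // x _;
    [exact: cvg_fst|exact: cvg_snd].
have [i Bx BV] := bB x V xV; have [j Bx' BV'] := bB' x' V' xV'.
exists (@choice.pickle (nat * nat)%type (i, j)); rewrite choice.pickleK //.
by move=> [y y'] [/= /BV ? /BV' ?]; apply: VW.
Qed.

(** * Point masses and essentially free actions *)

Section dirac_or_free.
Variables (R : realType) (G1 G2 : topologicalGroupType).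
Hypotheses (G1_lcsc : lcsc G1) (G1_simple : simple_tgroup G1)
  (G1_nonamenable : ~ amenable R G1)
  (G2_discrete : forall A : set G2, open A)
  (G2_countable : countable [set: G2]) (G2_simple : simple_tgroup G2).
Variables (d : measure_display) (X : measurableType d) (m : probability X R).
Variable a : G1 * G2 -> X -> X.
Hypotheses (a_action : is_group_action a)
  (a_measurable : forall g, measurable_fun setT (a g))
  (a_mp : measure_preserving m a) (a_irr : irreducible m a).
Variable S : nat -> set X.
Hypothesis S_measurable : forall n,
  measurable [set p : borel (G1 * G2)%type * X | S n (a p.1 p.2)].
Hypothesis S_separating : forall x y, (forall n, S n x <-> S n y) -> x = y.

(** Stated with a separating sequence of sets so as to apply both to standard Borel
    spaces and to spaces of closed subgroups. *)
Theorem dirac_or_free :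
  (exists2 x0, (forall g, a g x0 = x0) & \forall x \ae m, x = x0) \/
  \forall x \ae m, stabilizer a x = [set 1%g].
Proof.
have [[x0 ax0]|nd] := pselect (exists x0, \forall x \ae m, x = x0); [left|right].
  exists x0 => // g.
  have [x [-> ]] := ae_exists (filterI ax0 (ae_preimage (a_measurable g) (a_mp g) ax0)).
  by [].
have [hG lG sG] := G1_lcsc.
have [mu haar_mu] := haar_exists R G1_lcsc.
have [B bB] := lcsc_compact_basis hG lG sG.
pose b (g : G1) := a (g, 1%g).
have b_action : is_group_action b.
  case: a_action => b1 bM; split=> [x|g h x]; first exact: b1.
  have e : ((g * h)%g, 1%g) = ((g, 1%g) * (h, 1%g))%g :> G1 * G2.
    by rewrite -[1%g in LHS]mulg1.
  by rewrite /b e bM.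
have bS n : measurable [set p : borel G1 * X | S n (b p.1 p.2)].
  have incl : measurable_fun setT (fun g : borel G1 => (g, 1%g : G2) : borel (G1 * G2)%type).
    apply: (@continuous_borel G1 ((G1 * G2)%type : topologicalGroupType)
      (fun g : G1 => (g, 1%g : G2))).
    by apply: continuous_pair => g; [exact: cvg_id|exact: cvg_cst].
  have m1 : measurable_fun setT (fun p : borel G1 * X =>
      (((p.1, 1%g) : borel (G1 * G2)%type), p.2)).
    apply/measurable_fun_pairP; split; last exact: measurable_snd.
    exact: (measurableT_comp incl (@measurable_fst _ _ (borel G1) X)).
  rewrite -[X in measurable X]setTI.
  exact: (m1 measurableT _ (S_measurable n)).
have [c [mc cc sc]] := orbit_continuous_coordinates G1_lcsc b_action bS S_separating haar_mu.
exact: (essentially_free_of_not_dirac G1_lcsc G1_simple G1_nonamenable G2_discrete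
  G2_countable G2_simple a_action a_measurable a_mp a_irr mc cc sc bB nd).
Qed.

End dirac_or_free.

(** The sets are the balls of radius [1 / (N + 1)] about the points of a countable
    dense subset, indexed by the code of the center and by [N]. *)
Lemma standard_borel_separating (R : realType) d (X : measurableType d) :
  standard_borel R X -> exists S : nat -> set X,
    (forall n, measurable (S n)) /\
    forall x y, (forall n, S n x <-> S n y) -> x = y.
Proof.
move=> [Y [f [hY [D cD dD] [g gf fg] fm]]].
have [code codeI] := countable_injP _ cD.
pose O (p : nat * nat) := \bigcup_(y in [set y | D y /\ code y = p.1])
  (ball y (p.2.+1%:R^-1 : R))°.
have oO p : open (O p) by apply: bigcup_open => y _; exact: open_interior.
exists (fun n => if (@choice.unpickle (nat * nat)%type n) is Some p then f @^-1` O p else set0).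
split=> [n|x x' H].
  case: choice.unpickle => [p|]; last exact: measurable0.
  apply/fm; rewrite (_ : _ @` _ = O p); first exact: sub_sigma_algebra.
  apply/seteqP; split=> [_ [x Ox <-]//|y Oy].
  by exists (g y); rewrite /preimage/= fg.
have {}H p : O p (f x) <-> O p (f x').
  by have := H (@choice.pickle (nat * nat)%type p); rewrite choice.pickleK.
apply: (can_inj gf); apply/eqP; apply: contrapT => /negP ne.
have := hY; rewrite open_hausdorff => /(_ _ _ ne)[[U V]] /= [/set_mem Ux /set_mem Vx'] [oU oV UV].
have /nbhs_ballP[e e0 eU] : nbhs (f x) U by exact: open_nbhs_nbhs.
have e2 : 0 < e / 2 by rewrite divr_gt0.
have [N _ /(_ N (leqnn N)) /= HN] := near_infty_natSinv_lt (PosNum e2).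
pose r : R := N.+1%:R^-1; have r0 : 0 < r by rewrite invr_gt0.
have r2 : 0 < r / 2 by rewrite divr_gt0.
have [y [/= xy Dy]] : (ball (f x) (r / 2))° `&` D !=set0.
  apply: dD; last exact: open_interior.
  by exists (f x); exact: nbhsx_ballx.
have yx : O (code y, N) (f x).
  exists y => //=; apply/nbhs_ballP; exists (r / 2) => //= z xz.
  rewrite -/r (splitr r); apply: ball_triangle xz; apply: ball_sym.
  exact: interior_subset xy.
have [y' [Dy' cy'] /interior_subset yx'] := (H (code y, N)).1 yx.
have y'y : y' = y by apply: codeI; rewrite ?inE.
have : (U `&` V) (f x').
  split=> //; apply: eU; have er : r / 2 + r <= e.
    by move: HN r0; rewrite -/r; lra.
  apply: le_ball er _ _; apply: ball_triangle; first exact: interior_subset xy.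
  by rewrite y'y in yx'.
by rewrite (eqP UV).
Qed.

Section chabauty_separating.
Variables (G : topologicalGroupType) (O : nat -> set G).
Hypothesis bO : open_basis O.

Definition hits n : set (borel (closedSubgroup G)) :=
  [set H : closedSubgroup G | (H : set G) `&` O n !=set0].

(** A closed set is determined by the basic open sets that it meets. *)
Lemma hits_separating (H K : closedSubgroup G) :
  (forall n, hits n H <-> hits n K) -> H = K.
Proof.
have sub (H' K' : closedSubgroup G) : (forall n, hits n H' -> hits n K') ->
    (H' : set G) `<=` K'.
  move=> HK x Hx; apply: csub_closed => V xV.
  have [n Ox OV] := bO.2 x V xV.
  have [y [Ky Oy]] : hits n K' by apply: HK; exists x.
  by exists y; split=> //; exact: OV.
move=> HK; apply: closedSubgroup_eq; apply/seteqP.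
by split; apply: sub => n /HK.
Qed.

(** The condition is open in the group variable and in the element of the subgroup
    that witnesses it, so that it decomposes over countably many pairs of basic
    open sets. *)
Lemma hits_measurable n :
  measurable [set p : borel G * borel (closedSubgroup G) | hits n (conj_csub p.1 p.2)].
Proof.
have mO i : measurable (O i : set (borel G)) by apply: borel_open; exact: bO.1.
have mh j : measurable (hits j).
  by apply: borel_open; apply: chabauty_hit_open; exact: bO.1.
pose inside i j := forall g x, O i g -> O j x -> O n (x ^ g^-1)%g.
have -> : [set p : borel G * borel (closedSubgroup G) | hits n (conj_csub p.1 p.2)] =
    \bigcup_i \bigcup_j (if `[< inside i j >] then O i `*` hits j else set0).
  apply/seteqP; split=> [[g H] [x [/= Hx Ox]]|[g H] [i _ [j _]]].
    have cq : continuous (fun q : G * G => (q.2 ^ q.1^-1)%g).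
      have cid := @continuous_idfun (G * G)%type.
      have c1 := continuous_invg (continuous_fst_comp cid).
      apply: (@continuous_mulg (G * G)%type G (fun q => (q.1^-1)^-1%g)
        (fun q => q.2 * q.1^-1)%g); first exact: continuous_invg.
      by apply: continuous_mulg => //; exact: continuous_snd_comp.
    have nO : nbhs ((x ^ g)%g ^ g^-1)%g (O n).
      by rewrite conjgK; apply: open_nbhs_nbhs; split=> //; exact: bO.1.
    have [[V W] /= [gV xW] VW] := cq (g, (x ^ g)%g) _ nO.
    have [i Og OV] := bO.2 _ _ gV; have [j Ox' OW] := bO.2 _ _ xW.
    exists i => //; exists j => //; case: asboolP => [_|[]].
      by split=> //=; exists (x ^ g)%g; split.
    by move=> g' x' /OV Vg' /OW Wx'; exact: (VW (g', x')).
  case: asboolP => // ij [/= Og [x [Hx Ox]]].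
  exists (x ^ g^-1)%g; split; last exact: ij.
  by rewrite /= /conj_set/= conjgKV.
apply: bigcup_measurable => i _; apply: bigcup_measurable => j _.
by case: ifP => _; [exact: measurableX|exact: measurable0].
Qed.

End chabauty_separating.

(** * Actions and invariant random subgroups of the product *)

Theorem corollary1p5 (R : realType) (G1 G2 : topologicalGroupType)
    (G1_lcsc : lcsc G1) (G1_simple : simple_tgroup G1)
    (G1_nonamenable : ~ amenable R G1)
    (G2_discrete : forall A : set G2, open A)
    (G2_countable : countable [set: G2]) (G2_simple : simple_tgroup G2) :
  (forall (d : measure_display) (X : measurableType d) (m : probability X R)
      (a : G1 * G2 -> X -> X),
    pmp_action m a -> irreducible m a -> ~ trivial_action m a ->
    essentially_free m a) /\
  (forall (d : measure_display) (Omega : measurableType d)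
      (P : probability Omega R)
      (K : {RV P >-> borel (closedSubgroup (G1 * G2)%type)}),
    irreducible_IRS K ->
    exists N : closedSubgroup (G1 * G2)%type,
      normal_csub N /\ \forall w \ae P, K w = N).
Proof.
split=> [d X m a [sX act mact mp] irr ntriv|d Omega P K [irs irr]].
  have [S [mS sS]] := standard_borel_separating sX.
  have ma g : measurable_fun setT (a g).
    exact: (measurableT_comp mact (pair1_measurable (g : borel (G1 * G2)%type))).
  have mSa n : measurable [set p : borel (G1 * G2)%type * X | S n (a p.1 p.2)].
    by rewrite -[X in measurable X]setTI; exact: mact.
  have [[x0 fx0 ax0]|//] := dirac_or_free G1_lcsc G1_simple G1_nonamenable
    G2_discrete G2_countable G2_simple act ma mp irr mSa sS.
  by exfalso; apply: ntriv => g; apply: filterS ax0 => x ->.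
have [hG lG sG] := G1_lcsc.
have [V1 bV1] := second_countable_open_basis sG.
have [V2 bV2] := countable_open_basis G2_discrete G2_countable.
have [V bO] := prod_open_basis bV1 bV2.
have mc (g : G1 * G2) : measurable_fun setT
    (@conj_csub _ g : borel (closedSubgroup (G1 * G2)%type) ->
      borel (closedSubgroup (G1 * G2)%type)).
  exact: continuous_borel (@conj_csub_continuous _ g).
have aeP (Q : set (closedSubgroup (G1 * G2)%type)) :
    (\forall H \ae distribution P K, Q H) -> \forall w \ae P, Q (K w).
  move=> [A [mA A0 QA]]; exists (K @^-1` A); split=> //.
    by rewrite -[X in measurable X]setTI; exact: measurable_funP.
  by move=> w nQ; exact: QA.
pose G : topologicalGroupType := (G1 * G2)%type.
pose a (g : G1 * G2) : borel (closedSubgroup G) -> borel (closedSubgroup G) := @conj_csub G g.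
have act : is_group_action a := @conj_csub_action G.
have [[N fN aN]|free] := dirac_or_free (a := a) G1_lcsc G1_simple G1_nonamenable
    G2_discrete G2_countable G2_simple act mc irs irr (hits_measurable bO)
    (hits_separating bO).
  by exists N; split; [exact: fN|exact: (aeP _ aN)].
(* The elements of [H] fix [H], so that a trivial stabilizer forces [H] to be
   trivial. *)
have triv : \forall H \ae distribution P K,
    csub_set (H : closedSubgroup G) = [set 1%g].
  apply: filterS free => H stab1; apply/seteqP; split=> [h Hh|_ ->]; last exact: csub1.
  by rewrite -stab1; exact: conj_csub_self.
have [N N1] := ae_exists triv; exists N; split.
  by apply: normal_csubP => x g; rewrite N1 => /= ->; rewrite conj1g.
apply: (aeP (fun H => H = N)); have [A [mA A0 HA]] := triv.
exists A; split=> // H nH; apply: HA => /= H1; apply: nH.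
by apply: closedSubgroup_eq; rewrite H1 N1.
Qed.
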